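(* Let $\mathbf{H}$ be a complex Hilbert space, let $\mathcal{N}$ be a nest of $\mathbf{H}$, and let $\mathrm{Alg}(\mathcal{N})$ be the nest algebra associated with $\mathcal{N}$. Let $\mathfrak{q}\colon\mathrm{Alg}(\mathcal{N})\times\mathrm{Alg}(\mathcal{N})\to\mathrm{Alg}(\mathcal{N})$ be a $\mathbb{C}$-bilinear mapping. Then every centralizing trace $\mathfrak{T}_{\mathfrak q}\colon\mathrm{Alg}(\mathcal{N})\to\mathrm{Alg}(\mathcal{N})$ of $\mathfrak{q}$ is proper; that is, if $\mathfrak{T}_{\mathfrak q}(T)=\mathfrak{q}(T,T)$ is centralizing, then it is proper.
   Context: A nest on $\mathbf{H}$ is a chain $\mathcal{N}$ of closed subspaces of $\mathbf{H}$ that contains $0$ and $\mathbf{H}$ and is closed under arbitrary intersections and closed linear spans; $\mathrm{Alg}(\mathcal{N})$ is the algebra of all bounded linear operators $T$ on $\mathbf{H}$ with $T(N)\subseteq N$ for all $N\in\mathcal{N}$. For a unital $\mathbb{C}$-algebra $\mathcal{A}$ with center $\mathcal{Z}(\mathcal{A})$, and $[x,y]=xy-yx$: the trace of a bilinear mapping $\mathfrak{q}\colon\mathcal{A}\times\mathcal{A}\to\mathcal{A}$ is $\mathfrak{T}_{\mathfrak q}(a)=\mathfrak{q}(a,a)$. It is centralizing if $[\mathfrak{T}_{\mathfrak q}(a),a]\in\mathcal{Z}(\mathcal{A})$ for all $a\in\mathcal{A}$. A centralizing trace $\mathfrak{T}_{\mathfrak q}$ is proper if $\mathfrak{T}_{\mathfrak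 q}(a)=za^2+\mu_1(a)a+\mu_2(a)$ for all $a\in\mathcal{A}$, where $z\in\mathcal{Z}(\mathcal{A})$, $\mu_1\colon\mathcal{A}\to\mathcal{Z}(\mathcal{A})$ is linear, and $\mu_2\colon\mathcal{A}\to\mathcal{Z}(\mathcal{A})$ is the trace of a bilinear mapping $\mathcal{A}\times\mathcal{A}\to\mathcal{Z}(\mathcal{A})$. *)

(* Defs.v *)
From HB Require Import structures.
From mathcomp Require Import all_boot all_order all_algebra.
From mathcomp Require Import complex.
From mathcomp Require Import boolp classical_sets functions reals topology normedtype.

Set Implicit Arguments.
Unset Strict Implicit.
Unset Printing Implicit Defensive.

Import Order.TTheory GRing.Theory Num.Theory.
Import numFieldNormedType.Exports.

Local Open Scope classical_set_scope.
Local Open Scope ring_scope.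
Local Open Scope complex_scope.

(* The norm of a normed module over R[i] takes its values in R[i], in the
   nonnegative reals.  The inner product is linear in its first argument. *)
HB.mixin Record CompleteNormedModule_isHilbert (R : realType) H
    of CompleteNormedModule R[i] H := {
  inner : {dot H for (@Num.conj R[i])};
  inner_norm : forall x : H, inner x x = `|x| ^+ 2
}.

#[short(type="hilbertType")]
HB.structure Definition Hilbert (R : realType) :=
  {H of CompleteNormedModule R[i] H & CompleteNormedModule_isHilbert R H}.

Section Nests.
Context {R : realType} {H : hilbertType R}.

Definition linear_subspace (M : set H) : Prop :=
  M 0 /\ forall (c : R[i]) x y, M x -> M y -> M (c *: x + y).

Definition closed_subspace (M : set H) : Prop := linear_subspace M /\ closed M.

Definition linear_span (A : set H) : set H := smallest linear_subspace A.

Definition closed_span (F : set (set H)) : set H :=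
  closure (linear_span (\bigcup_(M in F) M)).

Definition is_nest (N : set (set H)) : Prop :=
  [/\ forall M, N M -> closed_subspace M,
      total_on N subset,
      N [set 0] /\ N [set: H],
      forall F, F `<=` N -> N (\bigcap_(M in F) M)
    & forall F, F `<=` N -> N (closed_span F)].

Definition bounded_operator (T : H -> H) : Prop :=
  linear T /\ exists C : R, forall x, `|T x| <= C%:C * `|x|.

End Nests.

Record nest (R : realType) (H : hilbertType R) := Nest {
  nest_set : set (set H);
  nestP : is_nest nest_set
}.

Section NestAlgebra.
Context {R : realType} {H : hilbertType R} (N : nest H).

Definition alg_set : set (H -> H) :=
  [set T | bounded_operator T /\ forall M, nest_set N M -> T @` M `<=` M].

Record nest_alg : Type := NestAlg {
  nest_alg_op :> H -> H;
  nest_algP : nest_alg_op \in alg_set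
}.

HB.instance Definition _ := [isSub for nest_alg_op].
HB.instance Definition _ := [Choice of nest_alg by <:].

Lemma nest_subspace M : nest_set N M -> linear_subspace M.
Proof. by case: (nestP N) => h _ _ _ _ /h []. Qed.

Lemma alg_set_subsemimod : GRing.subsemimod_closed (mem alg_set).
Proof.
split; first split.
- apply/mem_set; split; first split.
  + by move=> c x y; rewrite /= scaler0 addr0.
  + by exists 0 => x; rewrite /= normr0 mul0r.
  + by move=> M /nest_subspace [M0 _] _ [x _ <-].
- move=> S T /set_mem [[Sl [C SC]] SN] /set_mem [[Tl [D TD]] TN].
  apply/mem_set; split; first split.
  + by move=> c x y; rewrite !fctE Sl Tl scalerDr addrACA.
  + exists (C + D) => x; rewrite fctE rmorphD mulrDl.
    exact: le_trans (ler_normD _ _) (lerD (SC x) (TD x)).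
  + move=> M NM _ [x Mx <-]; have [_ ML] := nest_subspace NM.
    have /= := ML 1 (S x) (T x) (SN _ NM _ (ex_intro2 _ _ x Mx erefl))
      (TN _ NM _ (ex_intro2 _ _ x Mx erefl)).
    by rewrite scale1r.
- move=> a T /set_mem [[Tl [D TD]] TN].
  apply/mem_set; split; first split.
  + by move=> c x y; rewrite !fctE Tl scalerDr !scalerA mulrC.
  + exists (Normc.normc a * D) => x; rewrite fctE normrZ rmorphM -mulrA.
    exact: ler_wpM2l.
  + move=> M NM _ [x Mx <-]; have [M0 ML] := nest_subspace NM.
    have /= := ML a (T x) 0 (TN _ NM _ (ex_intro2 _ _ x Mx erefl)) M0.
    by rewrite addr0.
Qed.

HB.instance Definition _ :=
  GRing.SubChoice_isSubLmodule.Build R[i] (H -> H) (mem alg_set) nest_alg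
    alg_set_subsemimod.

Lemma alg_set_id : idfun \in alg_set.
Proof.
apply/mem_set; split; first split=> //.
- by exists 1 => x; rewrite mul1r.
- by move=> M _ _ [x Mx <-].
Qed.

Lemma alg_set_comp (S T : nest_alg) : S \o T \in alg_set.
Proof.
have [[Sl [C SC]] SN] := set_mem (nest_algP S).
have [[Tl [D TD]] TN] := set_mem (nest_algP T).
apply/mem_set; split; first split.
- by move=> c x y; rewrite /= Tl Sl.
- exists (`|C| * D) => x; rewrite rmorphM -mulrA /=.
  have C0 : 0 <= `|C|%:C by rewrite lecR.
  apply: le_trans (ler_wpM2l C0 (TD x)).
  apply: le_trans (SC _) _; apply: ler_wpM2r => //.
  by rewrite lecR ler_norm.
- move=> M NM _ [x Mx <-]; apply: (SN M NM); exists (T x) => //.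
  by apply: (TN M NM); exists x.
Qed.

Definition nest_alg_one : nest_alg := NestAlg alg_set_id.
Definition nest_alg_mul (S T : nest_alg) : nest_alg :=
  NestAlg (alg_set_comp S T).

Lemma nest_alg_linear (T : nest_alg) : linear T.
Proof. by have [[]] := set_mem (nest_algP T). Qed.

Lemma nest_alg_mulA : associative nest_alg_mul.
Proof. by move=> S T U; apply: val_inj. Qed.

Lemma nest_alg_mul1l : left_id nest_alg_one nest_alg_mul.
Proof. by move=> S; apply: val_inj. Qed.

Lemma nest_alg_mul1r : right_id nest_alg_one nest_alg_mul.
Proof. by move=> S; apply: val_inj. Qed.

Lemma nest_alg_mulDl : left_distributive nest_alg_mul +%R.
Proof. by move=> S T U; apply: val_inj. Qed.

Lemma nest_alg_mulDr : right_distributive nest_alg_mul +%R.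
Proof.
move=> S T U; apply: val_inj; apply/funext => x /=.
have := nest_alg_linear S 1 (T x) (U x); rewrite !scale1r; exact.
Qed.

(* Only a pzRingType: 1 = 0 when H is the zero space. *)
HB.instance Definition _ := GRing.Zmodule_isPzRing.Build nest_alg
  nest_alg_mulA nest_alg_mul1l nest_alg_mul1r nest_alg_mulDl nest_alg_mulDr.

Lemma nest_alg_scaleAl (a : R[i]) (S T : nest_alg) : a *: (S * T) = (a *: S) * T.
Proof. exact: val_inj. Qed.

Lemma nest_alg_scaleAr (a : R[i]) (S T : nest_alg) : a *: (S * T) = S * (a *: T).
Proof.
apply: val_inj; apply/funext => x /=.
have S0 : S 0 = 0 by have := nest_alg_linear S (-1) 0 0; rewrite scaler0 addr0 scaleN1r addNr.
by have := nest_alg_linear S a (T x) 0; rewrite !addr0 S0 addr0 => ->.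
Qed.

End NestAlgebra.

Section Center.
Context {A : pzRingType}.

Definition ring_commutator (x y : A) : A := x * y - y * x.

Definition ring_center : set A := [set z | forall x, z * x = x * z].

Definition centralizing (t : A -> A) : Prop :=
  forall a, ring_center (ring_commutator (t a) a).

End Center.

Definition trace_of (A B : Type) (q : A -> A -> B) : A -> B := fun a => q a a.

(* Maps into the center are represented as maps into the whole algebra with
   central values. *)
Definition proper_trace (R : realType) (H : hilbertType R) (N : nest H)
    (t : nest_alg N -> nest_alg N) : Prop :=
  exists (z : nest_alg N) (mu1 : {linear nest_alg N -> nest_alg N})
         (mu2 : nest_alg N -> nest_alg N),
    [/\ ring_center z,
        forall a, ring_center (mu1 a),
        exists2 b : {bilinear nest_alg N -> nest_alg N -> nest_alg N},
          (forall x y, ring_center (b x y)) & mu2 = trace_of b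
      & forall a, t a = z * a ^+ 2 + mu1 a * a + mu2 a].

(* Main.v *)
Require Import Defs.
From HB Require Import structures.
From mathcomp Require Import all_boot all_order all_algebra.
From mathcomp Require Import complex ring lra interval_inference.
From mathcomp Require Import boolp classical_sets functions reals topology normedtype.

(* Polarizing, q(a,a) is half of B(a,a) for a symmetric bilinear B, and
   [B(a,a),a] is a scalar, hence 0 because a nonzero scalar is not a commutator
   of bounded operators (Wintner); so [B(x,y),a] + [B(y,a),x] + [B(a,x),y] = 0.
   Unless all operators are scalar, 1 = p + q for idempotents p, q such that
   every operator of rank one from the range of q to the range of p lies in the
   algebra: p projects onto a proper member of the nest, or onto a line if there
   is none.  Only this property of the corner pAq and two facts on the corners
   pAp and qAq are used: their centers are scalar and their commuting linear maps
   have the form a |-> k a + scalar.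
   On the subalgebra S = {a | qap = 0}, the values B(a,p) are determined by
   commuting linear maps on the corners, which dictates z and mu such that
   B'(x,y) = B(x,y) - z(xy + yx) - mu(x)y - mu(y)x has B'(a,p) scalar for a in S.
   The identity above then makes B' scalar on S x S.  Finally, for t in qAp, the
   map s |-> B'(s,t) is commuting on S, which gives the value of mu at t. *)

Set Implicit Arguments.
Unset Strict Implicit.
Unset Printing Implicit Defensive.

Import Order.TTheory GRing.Theory Num.Theory.

Local Open Scope ring_scope.

(** * Normalization of noncommutative polynomials *)

(** The facts on the corners threaten an infinite descent, since an interval of the nest may be cut
    again and again. Two cuts suffice: the link between p and q through pAq alone makes the center
    of (p + q)A(p + q) scalar, and that link together with scalar centers of pAp and qAq gives the
    form of commuting maps on p + q. An interval that no nest member cuts contains all its rank one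
    operators, and there a rank one idempotent makes the cut. The delicate point of the algebra is
    the value at p. On S, B(a,p) has three coefficients, on the blocks pap, paq and qaq, while z and
    mu(p) match only two of them; a remainder d times qaq is left. That d is 0, or can be made 0,
    comes from a relation x m + m y + a m b = 0 for all m in pAq, which forces a or b to be scalar.
    The corner qAp is 0 when p projects onto a nest member and nonzero when the nest is trivial; the
    argument treats both cases at once. *)

Record peirce (A : pzRingType) (p q : A) : Prop := Peirce {
  peirce_pp : p * p = p;
  peirce_qq : q * q = q;
  peirce_pq : p * q = 0;
  peirce_qp : q * p = 0 }.

Definition corner (A : pzRingType) (e f x : A) : Prop := e * x = x /\ x * f = x.

Inductive nc_expr (K : Type) :=
  | NCVar of nat | NCZero | NCOne | NCAdd of nc_expr K & nc_expr K | NCOpp of nc_expr K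
  | NCMul of nc_expr K & nc_expr K | NCScale of K & nc_expr K.

Arguments NCZero {K}.
Arguments NCOne {K}.
Arguments NCVar {K} _.

Section NonCommutativeNormalization.
Context {F : comNzRingType} {A : algType F}.
Variables (p q : A).

(* An atom x tagged Some (s, t) satisfies corner e f x, where e and f are p or q
   according to s and t; the atoms 0 and 1 are p and q themselves. *)
Variable env : seq (A * option (bool * bool)).

Definition nc_atom i := nth (0, None) env i.
Definition nc_idem (s : bool) := if s then p else q.

Fixpoint nc_eval (e : nc_expr F) : A :=
  match e with
  | NCVar i => (nc_atom i).1
  | NCZero => 0
  | NCOne => 1
  | NCAdd e1 e2 => nc_eval e1 + nc_eval e2
  | NCOpp e1 => - nc_eval e1
  | NCMul e1 e2 => nc_eval e1 * nc_eval e2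
  | NCScale k e1 => k *: nc_eval e1
  end.

Fixpoint nc_wf (l : seq (A * option (bool * bool))) : Prop :=
  match l with
  | [::] => True
  | (x, None) :: l' => nc_wf l'
  | (x, Some (s, t)) :: l' => corner (nc_idem s) (nc_idem t) x /\ nc_wf l'
  end.

(** [None] stands for a product that is 0 because the inner idempotents differ. The indices below 2
    are [p] and [q] themselves, which act as units on a matching neighbour and are absorbed. *)
Definition nc_consw a (w : seq nat) : option (seq nat) :=
  match w with
  | [::] => Some [:: a]
  | b :: w' =>
    match (nc_atom a).2, (nc_atom b).2 with
    | Some (_, t), Some (s, _) =>
      if Bool.eqb t s then
        if Nat.ltb a 2 then Some (b :: w')
        else if Nat.ltb b 2 then Some (a :: w') else Some (a :: b :: w')
      else None
    | _, _ => Some (a :: b :: w')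
    end
  end.

Fixpoint nc_catw w1 w2 :=
  match w1 with
  | [::] => Some w2
  | a :: w1' => match nc_catw w1' w2 with None => None | Some w => nc_consw a w end
  end.

Fixpoint nc_add (P Q : seq (F * seq nat)) :=
  match P with [::] => Q | m :: P' => m :: nc_add P' Q end.

Fixpoint nc_scale (k : F) (P : seq (F * seq nat)) :=
  match P with [::] => [::] | (l, w) :: P' => (k * l, w) :: nc_scale k P' end.

Fixpoint nc_mulm (k : F) (w : seq nat) (P : seq (F * seq nat)) :=
  match P with
  | [::] => [::]
  | (l, v) :: P' =>
    match nc_catw w v with
    | None => nc_mulm k w P'
    | Some u => (k * l, u) :: nc_mulm k w P'
    end
  end.

Fixpoint nc_mul (P Q : seq (F * seq nat)) :=
  match P with
  | [::] => [::]
  | (k, w) :: P' => nc_add (nc_mulm k w Q) (nc_mul P' Q)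
  end.

Fixpoint nc_norm (e : nc_expr F) : seq (F * seq nat) :=
  match e with
  | NCVar i => [:: (1, [:: i])]
  | NCZero => [::]
  | NCOne => [:: (1, [::])]
  | NCAdd e1 e2 => nc_add (nc_norm e1) (nc_norm e2)
  | NCOpp e1 => nc_scale (- 1) (nc_norm e1)
  | NCMul e1 e2 => nc_mul (nc_norm e1) (nc_norm e2)
  | NCScale k e1 => nc_scale k (nc_norm e1)
  end.

Fixpoint nc_eqw (v w : seq nat) :=
  match v, w with
  | [::], [::] => true
  | a :: v', b :: w' => if Nat.eqb a b then nc_eqw v' w' else false
  | _, _ => false
  end.

Fixpoint nc_insert (k : F) w (P : seq (F * seq nat)) :=
  match P with
  | [::] => [:: (k, w)]
  | (l, v) :: P' =>
    if nc_eqw v w then (l + k, v) :: P' else (l, v) :: nc_insert k w P'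
  end.

Fixpoint nc_collect (P : seq (F * seq nat)) :=
  match P with
  | [::] => [::]
  | (k, w) :: P' => nc_insert k w (nc_collect P')
  end.

(** The coefficients are symbolic, so their vanishing cannot be computed: each collected monomial
    leaves one equation in [F], which the tactic passes to [ring] or [field]. *)
Fixpoint nc_all0 (P : seq (F * seq nat)) : Prop :=
  match P with [::] => True | (k, _) :: P' => k = 0 /\ nc_all0 P' end.

Fixpoint nc_word (w : seq nat) : A :=
  match w with [::] => 1 | a :: w' => (nc_atom a).1 * nc_word w' end.

Fixpoint nc_poly (P : seq (F * seq nat)) : A :=
  match P with [::] => 0 | (k, w) :: P' => k *: nc_word w + nc_poly P' end.

Hypothesis pq : peirce p q.
Hypothesis env_wf : nc_wf env.
Hypothesis env0 : nc_atom 0 = (p, Some (true, true)).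
Hypothesis env1 : nc_atom 1 = (q, Some (false, false)).

Lemma nc_atom_wf i s t :
  (nc_atom i).2 = Some (s, t) -> corner (nc_idem s) (nc_idem t) (nc_atom i).1.
Proof.
rewrite /nc_atom; elim: env env_wf i => [|[x [[u v]|]] l IH] /=.
- by move=> _ i; rewrite nth_nil.
- by case=> hx hl [|i] /=; [case=> <- <- | exact: IH].
- by move=> hl [|i] //=; exact: IH.
Qed.

Definition nc_oword (w : option (seq nat)) := if w is Some v then nc_word v else 0.

Lemma nc_consw_correct a w : nc_oword (nc_consw a w) = (nc_atom a).1 * nc_word w.
Proof.
case: pq => pp qq p0 q0.
case: w => [|b w] //=.
case ta: (nc_atom a).2 => [[s t]|] //; case tb: (nc_atom b).2 => [[s' t']|] //.
have [la ra] := nc_atom_wf ta; have [lb rb] := nc_atom_wf tb.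
case: ifP => [/Bool.eqb_prop ?|ts]; last first.
  have ts0 : nc_idem t * nc_idem s' = 0 by move: ts; case: (t); case: (s').
  rewrite -[(nc_atom a).1]ra -[(nc_atom b).1]lb /= !mulrA -(mulrA _ (nc_idem t)).
  by rewrite ts0 mulr0 !mul0r.
subst s'.
case: ifP => [|_].
  move: ta; case: a {la ra} => [|[|a]] //; rewrite (env0, env1) /= => -[_ ?];
  by subst; rewrite mulrA lb.
case: ifP => [|_] //.
move: tb; case: b {lb rb} => [|[|b]] //; rewrite (env0, env1) /= => -[? _] _;
by subst; rewrite mulrA ra.
Qed.

Lemma nc_catw_correct v w : nc_oword (nc_catw v w) = nc_word v * nc_word w.
Proof.
elim: v => [|a v IH] /=; first by rewrite mul1r.
rewrite -mulrA -IH; case: (nc_catw v w) => [u|] /=; last by rewrite mulr0.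
exact: nc_consw_correct.
Qed.

Lemma nc_add_correct P Q : nc_poly (nc_add P Q) = nc_poly P + nc_poly Q.
Proof. by elim: P => [|[k w] P IH] /=; rewrite ?add0r // IH addrA. Qed.

Lemma nc_scale_correct k P : nc_poly (nc_scale k P) = k *: nc_poly P.
Proof.
by elim: P => [|[l w] P IH] /=; rewrite ?scaler0 // IH scalerDr scalerA.
Qed.

Lemma nc_mulm_correct k w P : nc_poly (nc_mulm k w P) = k *: (nc_word w * nc_poly P).
Proof.
elim: P => [|[l v] P IH] /=; first by rewrite mulr0 scaler0.
rewrite mulrDr scalerDr -IH -scalerAr scalerA -nc_catw_correct.
by case: (nc_catw w v) => [u|] //=; rewrite scaler0 add0r.
Qed.

Lemma nc_mul_correct P Q : nc_poly (nc_mul P Q) = nc_poly P * nc_poly Q.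
Proof.
elim: P => [|[k w] P IH] /=; first by rewrite mul0r.
by rewrite nc_add_correct nc_mulm_correct IH mulrDl scalerAl.
Qed.

Lemma nc_norm_correct e : nc_poly (nc_norm e) = nc_eval e.
Proof.
elim: e => [i|||e1 IH1 e2 IH2|e IH|e1 IH1 e2 IH2|k e IH] //=.
- by rewrite scale1r mulr1 addr0.
- by rewrite scale1r addr0.
- by rewrite nc_add_correct IH1 IH2.
- by rewrite nc_scale_correct IH scaleN1r.
- by rewrite nc_mul_correct IH1 IH2.
- by rewrite nc_scale_correct IH.
Qed.

Lemma nc_eqwP v w : nc_eqw v w -> v = w.
Proof.
elim: v w => [|a v IH] [|b w] //=; case: ifP => // /PeanoNat.Nat.eqb_eq -> /IH ->.
by [].
Qed.

Lemma nc_insert_correct k w P : nc_poly (nc_insert k w P) = k *: nc_word w + nc_poly P.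
Proof.
elim: P => [|[l v] P IH] //=; case: ifP => [/nc_eqwP -> | _] /=.
  by rewrite scalerDl addrAC addrC addrA.
by rewrite IH addrCA.
Qed.

Lemma nc_collect_correct P : nc_poly (nc_collect P) = nc_poly P.
Proof. by elim: P => [|[k w] P IH] //=; rewrite nc_insert_correct IH. Qed.

Lemma nc_all0_correct P : nc_all0 P -> nc_poly P = 0.
Proof. by elim: P => [|[k w] P IH] //= [-> /IH ->]; rewrite scale0r addr0. Qed.

Lemma nc_correct e1 e2 :
  nc_all0 (nc_collect (nc_norm (NCAdd e1 (NCOpp e2)))) -> nc_eval e1 = nc_eval e2.
Proof.
move=> h; apply/eqP; rewrite -subr_eq0; apply/eqP.
by rewrite -(nc_all0_correct h) nc_collect_correct nc_norm_correct.
Qed.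

End NonCommutativeNormalization.

Lemma peirce0 (A : pzRingType) : peirce (0 : A) 0.
Proof. by split; rewrite mul0r. Qed.

Lemma corner_idem (A : pzRingType) (e : A) : e * e = e -> corner e e e.
Proof. by []. Qed.

Ltac nc_insert_env x env p q :=
  match env with
  | [::] =>
    match goal with
    | _ : corner p p x |- _ => constr:([:: (x, Some (true, true))])
    | _ : corner p q x |- _ => constr:([:: (x, Some (true, false))])
    | _ : corner q p x |- _ => constr:([:: (x, Some (false, true))])
    | _ : corner q q x |- _ => constr:([:: (x, Some (false, false))])
    | _ => constr:([:: (x, @None (bool * bool))])
    end
  | (x, _) :: _ => env
  | ?h :: ?t => let t' := nc_insert_env x t p q in constr:(h :: t')
  end.

Ltac nc_atoms t env p q :=
  lazymatch t with
  | @GRing.add _ ?a ?b => let e := nc_atoms a env p q in nc_atoms b e p q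
  | @GRing.opp _ ?a => nc_atoms a env p q
  | @GRing.mul _ ?a ?b => let e := nc_atoms a env p q in nc_atoms b e p q
  | @GRing.scale _ _ _ ?a => nc_atoms a env p q
  | @GRing.zero _ => env
  | @GRing.one _ => env
  | _ => nc_insert_env t env p q
  end.

Ltac nc_index x env :=
  match env with
  | (x, _) :: _ => constr:(O)
  | _ :: ?t => let n := nc_index x t in constr:(S n)
  end.

Ltac nc_reify F t env :=
  lazymatch t with
  | @GRing.add _ ?a ?b =>
    let u := nc_reify F a env in let v := nc_reify F b env in constr:(@NCAdd F u v)
  | @GRing.opp _ ?a => let u := nc_reify F a env in constr:(@NCOpp F u)
  | @GRing.mul _ ?a ?b =>
    let u := nc_reify F a env in let v := nc_reify F b env in constr:(@NCMul F u v)
  | @GRing.scale _ _ ?k ?a => let u := nc_reify F a env in constr:(@NCScale F k u)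
  | @GRing.zero _ => constr:(@NCZero F)
  | @GRing.one _ => constr:(@NCOne F)
  | _ => let n := nc_index t env in constr:(@NCVar F n)
  end.

Ltac nc_run F p q pq a b :=
  let env0 := constr:([:: (p, Some (true, true)); (q, Some (false, false))]) in
  let env1 := nc_atoms a env0 p q in
  let env := nc_atoms b env1 p q in
  let u := nc_reify F a env in
  let v := nc_reify F b env in
  apply: (@nc_correct _ _ p q env pq _ erefl erefl u v);
  [ cbv [nc_wf nc_idem];
    repeat first [ exact: I
                 | split; [first [ eassumption
                                 | exact: (corner_idem (peirce_pp pq))
                                 | exact: (corner_idem (peirce_qq pq))] |] ]
  | cbv [nc_all0 nc_collect nc_insert nc_eqw nc_norm nc_add nc_scale nc_mul nc_mulm
         nc_catw nc_consw nc_atom nth Nat.ltb Nat.leb Nat.eqb Bool.eqb fst snd];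
    repeat first [ exact: I | split; [try first [by ring | by field] |] ] ].

(* If a hypothesis [peirce p q] is present, words are simplified with it and with
   all hypotheses of the form [corner p q x]. *)
Ltac nc_ring :=
  rewrite ?mulr2n;
  lazymatch goal with
  | |- @eq ?T ?a ?b =>
    match T with
    | context [?A] =>
      lazymatch type of A with
      | GRing.Algebra.type ?F =>
        let K := constr:(GRing.PzRing.sort F) in
        first
          [ match goal with
            | pq : peirce ?p ?q |- _ => nc_run K p q pq a b
            end
          | let z := constr:(@GRing.zero A) in nc_run K z z (@peirce0 A) a b ]
      end
    end
  end.

(** * Commuting maps on a Peirce decomposition *)

Section CommutingTraces.
Context {F : numFieldType} {A : algType F}.
Implicit Types (a b c e f m n p q u v x y : A) (j k l : F).

Local Notation comm := ring_commutator.

(** The working form of the block computations below: a relation [c = 0] is multiplied by chosen [u]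
    and [v], often idempotents that cut out one Peirce block, and a formal identity for [nc_ring]
    remains. *)
Lemma eq_by_zero a b c u v : c = 0 -> a = b + u * c * v -> a = b.
Proof. by move=> -> ->; rewrite mulr0 mul0r addr0. Qed.

Lemma eq_by_zero2 a b c u v c' u' v' :
  c = 0 -> c' = 0 -> a = b + u * c * v + u' * c' * v' -> a = b.
Proof. by move=> -> -> ->; rewrite !mulr0 !mul0r !addr0. Qed.

Definition multiple e x : Prop := exists k, x = k *: e.

Lemma multiple0 e : multiple e 0.
Proof. by exists 0; rewrite scale0r. Qed.

Lemma multipleD e x y : multiple e x -> multiple e y -> multiple e (x + y).
Proof. by case=> k -> [l ->]; exists (k + l); rewrite scalerDl. Qed.

Lemma multipleZ e k x : multiple e x -> multiple e (k *: x).
Proof. by case=> l ->; exists (k * l); rewrite scalerA. Qed.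

Lemma multipleZK e k x : k != 0 -> multiple e (k *: x) -> multiple e x.
Proof.
by move=> k0 [l h]; exists (k^-1 * l); rewrite -scalerA -h scalerA mulVf // scale1r.
Qed.

Lemma commutator_multiple1 c x : multiple 1 c -> comm c x = 0.
Proof. by case=> k ->; rewrite /ring_commutator; nc_ring. Qed.

Lemma scaler_inj0 e k : e != 0 -> k *: e = 0 -> k = 0.
Proof. by move=> /negbTE e0 /eqP; rewrite scaler_eq0 e0 orbF => /eqP. Qed.

Lemma scaler_left_inj e k l : e != 0 -> k *: e = l *: e -> k = l.
Proof.
move=> e0 h; apply/eqP; rewrite -subr_eq0; apply/eqP/(scaler_inj0 e0).
by rewrite scalerBl h subrr.
Qed.

Definition functional (mu : A -> F) : Prop :=
  forall k a b, mu (k *: a + b) = k * mu a + mu b.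

(** Turns scalars that are only known to exist, such as those of [multiple], into a linear
    functional: uniqueness makes the pointwise choice linear. *)
Lemma functional_choice (P : A -> F -> Prop) :
  (forall a, exists k, P a k) ->
  (forall a k l, P a k -> P a l -> k = l) ->
  (forall j a b k l, P a k -> P b l -> P (j *: a + b) (j * k + l)) ->
  exists2 mu, functional mu & forall a, P a (mu a).
Proof.
move=> /choice[mu hmu] uniq lin; exists mu => // k a b.
exact: uniq (hmu _) (lin _ _ _ _ _ (hmu a) (hmu b)).
Qed.

(** Since [x * m - m * y] is the commutator of [x + y] with [m], this says that a block diagonal
    element commuting with all of pAq is scalar. It makes the scalars found on the two diagonal
    blocks agree. *)
Definition linked p q : Prop := forall x y, corner p p x -> corner q q y ->
  (forall m, corner p q m -> x * m = m * y) -> exists k, x = k *: p /\ y = k *: q.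

Definition central_multiple e : Prop := forall c, corner e e c ->
  (forall x, corner e e x -> c * x = x * c) -> multiple e c.

(** The domain [D] may exceed the corner because the property is applied to maps such as a |-> p
    B(a,p) p on S, whose value also depends on the part of [a] outside pAp. Only [k] is uniform in
    [a]; the multiple of [e] absorbs that dependence. *)
Definition commuting_standard e : Prop := forall (D : A -> Prop) (f : A -> A),
  (forall a b, D a -> D b -> D (a + b)) -> (forall x, corner e e x -> D x) ->
  (forall a b, f (a + b) = f a + f b) ->
  (forall a, D a -> corner e e (f a)) ->
  (forall a, D a -> comm (f a) (e * a * e) = 0) ->
  exists k, forall a, D a -> multiple e (f a - k *: (e * a * e)).

Lemma commuting_standard_multiple e :
  (forall x, corner e e x -> multiple e x) -> commuting_standard e.
Proof.
move=> h D f _ _ _ fe _; exists 0 => a Da.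
by rewrite scale0r subr0; apply: h; exact: fe.
Qed.

Section Split.
Variables p q : A.
Hypothesis pq : peirce p q.

Lemma corner_peirce e f x :
  (e = p \/ e = q) -> (f = p \/ f = q) -> corner e f (e * x * f).
Proof. by case=> -> [] ->; split; nc_ring. Qed.

Lemma corner_pp x : corner p p (p * x * p). Proof. by apply: corner_peirce; left. Qed.
Lemma corner_qq x : corner q q (q * x * q). Proof. by apply: corner_peirce; right. Qed.
Lemma corner_pq x : corner p q (p * x * q).
Proof. by apply: corner_peirce; [left | right]. Qed.

Lemma peirce_decomp x : corner (p + q) (p + q) x ->
  x = p * x * p + p * x * q + q * x * p + q * x * q.
Proof. by move=> [h1 h2]; rewrite -[LHS]h1 -[in LHS]h2; nc_ring. Qed.

Section CommutingMap.
Hypotheses (link : linked p q) (cp : central_multiple p) (cq : central_multiple q).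
Variables (D : A -> Prop) (f : A -> A).
Hypothesis D_add : forall a b, D a -> D b -> D (a + b).
Hypothesis Dpp : forall x, corner p p x -> D x.
Hypothesis Dqq : forall x, corner q q x -> D x.
Hypothesis Dpq : forall x, corner p q x -> D x.
Hypothesis f_add : forall a b, f (a + b) = f a + f b.
Hypothesis f_corner : forall a, D a -> corner (p + q) (p + q) (f a).
Hypothesis f_comm : forall a, D a -> comm (f a) ((p + q) * a * (p + q)) = 0.

Local Notation e := (p + q).

Lemma commuting_map_sym a b : D a -> D b ->
  comm (f a) (e * b * e) + comm (f b) (e * a * e) = 0.
Proof.
move=> Da Db; have := f_comm (D_add Da Db); rewrite f_add /ring_commutator => h.
have h' : comm (f a) (e * a * e) + comm (f b) (e * b * e) = 0 by rewrite !f_comm // addr0.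
apply: (eq_by_zero2 (u := 1) (v := 1) (u' := -1) (v' := 1) h h').
by rewrite /ring_commutator; nc_ring.
Qed.

Lemma commuting_map_core l : f p = l *: e ->
  forall a, D a -> multiple e (f a).
Proof.
move=> fp; have ee : corner e e p by split; nc_ring.
have Dp : D p by apply: Dpp; split; nc_ring.
(* With [f p] scalar, the polarized relation at [p] says that [f a] commutes with [p]. *)
have dec a : D a -> f a = p * f a * p + q * f a * q.
  move=> Da; rewrite [LHS](peirce_decomp (f_corner Da)).
  have := commuting_map_sym Da Dp; rewrite fp /ring_commutator => h.
  apply: (eq_by_zero2 (u := - p) (v := q) (u' := q) (v' := p) h h).
  by nc_ring.
have fm m : corner p q m -> multiple e (f m).
  move=> hm; have Dm := Dpq hm.
  have [k hk] : multiple p (p * f m * p).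
    apply: cp (corner_pp _) _ => x hx.
    have := commuting_map_sym Dm (Dpp hx).
    rewrite (dec _ (Dpp hx)) /ring_commutator => h.
    by apply: (eq_by_zero (u := p) (v := p) h); nc_ring.
  have [k' hk'] : multiple q (q * f m * q).
    apply: cq (corner_qq _) _ => x hx.
    have := commuting_map_sym Dm (Dqq hx).
    rewrite (dec _ (Dqq hx)) /ring_commutator => h.
    by apply: (eq_by_zero (u := q) (v := q) h); nc_ring.
  have fmE : f m = k *: p + k' *: q by rewrite dec // hk hk'.
  have := f_comm Dm; rewrite fmE /ring_commutator => h.
  (* For nonzero [m], commuting with [m] makes the scalars of the two blocks equal; for [m = 0]
     additivity gives [f 0 = 0]. *)
  have /eqP : (k - k') *: m = 0 by apply: (eq_by_zero (u := 1) (v := 1) h); nc_ring.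
  rewrite scaler_eq0 subr_eq0 => /orP[/eqP -> | /eqP m0].
    by exists k'; rewrite scalerDr.
  have f0 : f 0 = 0.
    have := f_add 0 0; rewrite addr0 => /eqP.
    by rewrite -subr_eq0 opprD addNKr oppr_eq0 => /eqP.
  by rewrite -fmE m0 f0; exact: multiple0.
move=> a Da.
have [k] : exists k, p * f a * p = k *: p /\ q * f a * q = k *: q.
  apply: (link (corner_pp _) (corner_qq _)) => m hm.
  have [k hk] := fm _ hm.
  have := commuting_map_sym Da (Dpq hm); rewrite hk /ring_commutator => h.
  by apply: (eq_by_zero (u := p) (v := q) h); nc_ring.
by case=> h1 h2; exists k; rewrite dec // h1 h2 scalerDr.
Qed.

End CommutingMap.

Lemma commuting_map_sum (D : A -> Prop) (f : A -> A) :
  linked p q -> central_multiple p -> central_multiple q ->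
  (forall a b, D a -> D b -> D (a + b)) ->
  (forall x, corner p p x -> D x) -> (forall x, corner q q x -> D x) ->
  (forall x, corner p q x -> D x) ->
  (forall a b, f (a + b) = f a + f b) ->
  (forall a, D a -> corner (p + q) (p + q) (f a)) ->
  (forall a, D a -> comm (f a) ((p + q) * a * (p + q)) = 0) ->
  exists k, forall a, D a -> multiple (p + q) (f a - k *: ((p + q) * a * (p + q))).
Proof.
move=> link cp cq Dadd Dpp Dqq Dpq fadd fcorner fcomm.
have Dp : D p by apply: Dpp; split; nc_ring.
have sym := commuting_map_sym Dadd fadd fcomm.
have hp := fcomm _ Dp.
have [k hk] : multiple p (p * f p * p).
  apply: cp _ (corner_pp _) _ => x hx.
  have := sym _ _ Dp (Dpp _ hx); rewrite /ring_commutator => h.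
  by apply: (eq_by_zero (u := p) (v := p) h); nc_ring.
have [l hl] : multiple q (q * f p * q).
  apply: cq _ (corner_qq _) _ => x hx.
  have := sym _ _ Dp (Dqq _ hx); rewrite /ring_commutator => h.
  by apply: (eq_by_zero (u := q) (v := q) h); nc_ring.
have fp : f p = k *: p + l *: q.
  rewrite [LHS](peirce_decomp (fcorner _ Dp)) hk hl.
  move: hp; rewrite /ring_commutator => h.
  by apply: (eq_by_zero2 (u := - p) (v := q) (u' := q) (v' := p) h h); nc_ring.
(* Subtracting (k - l) times the compression of [a] turns [f p = k *: p + l *: q] into
   [l *: (p + q)], the case already settled. *)
exists (k - l).
pose g a := f a - (k - l) *: ((p + q) * a * (p + q)).
apply: (@commuting_map_core link cp cq D g Dadd Dpp Dqq Dpq _ _ _ l).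
- by move=> a b; rewrite /g fadd; nc_ring.
- move=> a Da; have [h1 h2] := fcorner _ Da.
  split; rewrite /g.
    by rewrite mulrBr h1; nc_ring.
  by rewrite mulrBl h2; nc_ring.
- move=> a Da; move: (fcomm _ Da); rewrite /g /ring_commutator => h.
  by apply: (eq_by_zero (u := 1) (v := 1) h); nc_ring.
- by rewrite /g fp; nc_ring.
Qed.

Lemma corner_sum g h x : (g = p \/ g = q) -> (h = p \/ h = q) ->
  corner g h x -> corner (p + q) (p + q) x.
Proof. by case=> -> [] -> hx; split; nc_ring. Qed.

Lemma commuting_standard_sum : linked p q -> central_multiple p ->
  central_multiple q -> commuting_standard (p + q).
Proof.
move=> link cp cq D f Dadd Dcorner; apply: commuting_map_sum => // x hx;
  apply: Dcorner; apply: corner_sum hx; by [left | right].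
Qed.

(** Commuting with pAq makes the block diagonal part scalar, and commuting with [p] removes the
    other blocks. The link alone decides, which ends the descent through finer intervals. *)
Lemma central_multiple_sum : linked p q -> central_multiple (p + q).
Proof.
move=> link c hc cc.
have cp : c * p = p * c by apply: cc; split; nc_ring.
have [k] : exists k, p * c * p = k *: p /\ q * c * q = k *: q.
  apply: (link _ _ (corner_pp _) (corner_qq _)) => m hm.
  have : c * m = m * c by apply: cc; split; nc_ring.
  move=> /eqP; rewrite -subr_eq0 => /eqP h.
  by apply: (eq_by_zero (u := p) (v := q) h); nc_ring.
case=> h1 h2; exists k; rewrite [LHS](peirce_decomp hc) h1 h2.
move/eqP: cp; rewrite -subr_eq0 => /eqP h.
by apply: (eq_by_zero2 (u := - p) (v := q) (u' := q) (v' := p) h h); nc_ring.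
Qed.

End Split.
End CommutingTraces.

(** * Commuting traces of bilinear maps *)

Section CommutingForms.
Context {F : numFieldType} {A : algType F}.
Implicit Types (a b c e f m n p q u v x y : A) (j k l : F).
Local Notation comm := ring_commutator.

Record commuting_form (B : A -> A -> A) : Prop := CommutingForm {
  form_sym : forall x y, B x y = B y x;
  form_lin : forall x, linear (B x);
  form_jacobi : forall x y a,
    comm (B x y) a + comm (B y a) x + comm (B a x) y = 0 }.

Section FormTheory.
Variable B : A -> A -> A.
Hypothesis BP : commuting_form B.

Lemma form0r x : B x 0 = 0.
Proof. by have := form_lin BP x (-1) 0 0; rewrite !scaleN1r oppr0 addr0 addNr. Qed.

Lemma formDr x y a : B x (y + a) = B x y + B x a.
Proof. by have := form_lin BP x 1 y a; rewrite !scale1r. Qed.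

Lemma formZr x k y : B x (k *: y) = k *: B x y.
Proof. by have := form_lin BP x k y 0; rewrite form0r !addr0. Qed.

Lemma formDl x y a : B (x + y) a = B x a + B y a.
Proof. by rewrite !(form_sym BP _ a) formDr. Qed.

Lemma formZl x k y : B (k *: x) y = k *: B x y.
Proof. by rewrite !(form_sym BP _ y) formZr. Qed.

End FormTheory.

Lemma commuting_form_of_diagonal (B : A -> A -> A) :
  (forall x y, B x y = B y x) -> (forall x, linear (B x)) ->
  (forall a, comm (B a a) a = 0) -> commuting_form B.
Proof.
move=> sym lin diag; split=> // x y a.
have DDr u v w : B u (v + w) = B u v + B u w by have := lin u 1 v w; rewrite !scale1r.
have DDl u v w : B (u + v) w = B u w + B v w by rewrite !(sym _ w) DDr.
have NNr u v : B u (- v) = - B u v.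
  have := lin u (-1) v 0; rewrite !scaleN1r !addr0 => ->.
  by have := lin u (-1) 0 0; rewrite !scaleN1r oppr0 addr0 addNr => ->; rewrite addr0.
have NNl u v : B (- u) v = - B u v by rewrite !(sym _ v) NNr.
have h2 u v : comm (B u u) v + comm (B u v) u + comm (B u v) u = 0.
  have := diag (u + v); have := diag (u - v).
  rewrite !DDr !DDl !NNr !NNl opprK (sym v u) /ring_commutator => h1 h3.
  (* Half the difference of the relations at u + v and u - v is the part odd in v; it still contains
     [B(v,v),v], which is removed here. *)
  have hv := diag v; rewrite /ring_commutator in hv.
  apply: (eq_by_zero2 (u := (2^-1 : F) *: 1) (v := 1) (u' := (-2^-1 : F) *: 1) (v' := 1) h3 h1).
  by apply: (eq_by_zero (u := -1) (v := 1) hv); rewrite /ring_commutator; nc_ring.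
have := h2 (x + y) a; rewrite !DDr !DDl (sym y x) => h.
have hx := h2 x a; have hy := h2 y a.
rewrite /ring_commutator in h hx hy *.
rewrite (sym a x).
apply: (eq_by_zero2 (u := (2^-1 : F) *: 1) (v := 1) (u' := (-2^-1 : F) *: 1) (v' := 1) h hx).
apply: (eq_by_zero (u := (-2^-1 : F) *: 1) (v := 1) hy).
by nc_ring.
Qed.

(** The standard form z(xy + yx) + mu(x)y + mu(y)x satisfies the cyclic identity itself, so every
    normalization below stays among commuting forms. *)
Lemma commuting_form_sub (B : A -> A -> A) z mu : commuting_form B -> functional mu ->
  commuting_form (fun x y => B x y - z *: (x * y + y * x) - mu x *: y - mu y *: x).
Proof.
move=> BP hmu; split=> [x y|x k y a /=|x y a].
- by rewrite (form_sym BP); nc_ring.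
- by rewrite (form_lin BP) /= hmu; nc_ring.
- have := form_jacobi BP x y a; rewrite /ring_commutator => h.
  by apply: (eq_by_zero (u := 1) (v := 1) h); nc_ring.
Qed.



(** The interface between the algebra and the operators. [split_linked2] serves to kill the offset
    at p; [split_left] and [split_right] kill the coefficient of x in B(x,m), and of y in B(y,m),
    for m in pAq. *)
Record good_splitting p q : Prop := GoodSplitting {
  split_peirce : peirce p q;
  split_sum : p + q = 1;
  split_p : p != 0;
  split_q : q != 0;
  split_linked : linked p q;
  split_linked2 : forall x y a b,
    corner p p x -> corner q q y -> corner p p a -> corner q q b ->
    (forall m, corner p q m -> x * m + m * y + a * m * b = 0) ->
    multiple p a \/ multiple q b;
  split_left : forall x, corner p p x ->
    (forall m, corner p q m -> multiple m (x * m)) -> multiple p x;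
  split_right : forall y, corner q q y ->
    (forall m, corner p q m -> multiple m (m * y)) -> multiple q y;
  split_central_p : central_multiple p;
  split_central_q : central_multiple q;
  split_commuting_p : commuting_standard p;
  split_commuting_q : commuting_standard q }.

(** * The value of a commuting form at the idempotent [p] *)

Section GoodSplitting.
Variables p q : A.
Hypothesis gs : good_splitting p q.

Let pq : peirce p q := split_peirce gs.
Let pq1 : p + q = 1 := split_sum gs.

Lemma peirce_decomp1 x : x = p * x * p + p * x * q + q * x * p + q * x * q.
Proof. by apply: (peirce_decomp pq); rewrite pq1; split; rewrite ?mul1r ?mulr1. Qed.

Definition triangular a : Prop := q * a * p = 0.

Lemma triangularP a : triangular a ->
  exists x m y, [/\ corner p p x, corner p q m, corner q q y & a = x + m + y].
Proof.
move=> Sa; exists (p * a * p), (p * a * q), (q * a * q).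
split; [exact: (corner_pp pq) | exact: (corner_pq pq) | exact: (corner_qq pq) |].
by rewrite [LHS]peirce_decomp1 Sa addr0.
Qed.

Lemma triangular_pp x : corner p p x -> triangular x.
Proof. by move=> hx; rewrite /triangular; nc_ring. Qed.

Lemma triangular_pq x : corner p q x -> triangular x.
Proof. by move=> hx; rewrite /triangular; nc_ring. Qed.

Lemma triangular_qq x : corner q q x -> triangular x.
Proof. by move=> hx; rewrite /triangular; nc_ring. Qed.

Lemma triangularD a b : triangular a -> triangular b -> triangular (a + b).
Proof. by rewrite /triangular => ha hb; rewrite mulrDr mulrDl ha hb addr0. Qed.

Lemma multiple_1 k : multiple 1 (k *: p + k *: q).
Proof. by exists k; rewrite -pq1 scalerDr. Qed.

Section Form.
Variable B : A -> A -> A.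
Hypothesis BP : commuting_form B.

Lemma form_jacobi2 a b : comm (B a a) b + 2 *: comm (B a b) a = 0.
Proof.
have := form_jacobi BP a a b; rewrite (form_sym BP b a) /ring_commutator => h.
by apply: (eq_by_zero (u := 1) (v := 1) h); nc_ring.
Qed.

Lemma form_pp : exists k l, B p p = k *: p + l *: q.
Proof.
have hp := form_jacobi2 p p; rewrite /ring_commutator in hp.
have [k hk] : multiple p (p * B p p * p).
  apply: (split_central_p gs) (corner_pp pq _) _ => x hx.
  have := form_jacobi2 p x; rewrite /ring_commutator => h.
  by apply: (eq_by_zero (u := p) (v := p) h); nc_ring.
have [l hl] : multiple q (q * B p p * q).
  apply: (split_central_q gs) (corner_qq pq _) _ => x hx.
  have := form_jacobi2 p x; rewrite /ring_commutator => h.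
  by apply: (eq_by_zero (u := q) (v := q) h); nc_ring.
exists k, l; rewrite [LHS]peirce_decomp1 hk hl.
(* At a = b = p the relation reads 3 [B(p,p),p] = 0, which kills the off-diagonal blocks. *)
apply: (eq_by_zero2 (u := (- 3^-1 : F) *: p) (v := q) (u' := (3^-1 : F) *: q) (v' := p) hp hp).
by nc_ring.
Qed.


(** Both blocks are read off [B(p,p),a] + 2 [b,p] = 0 for b = B(a,p), because [b,p] = qbp - pbq. *)
Lemma form_p_corners k l a : B p p = k *: p + l *: q -> triangular a ->
  q * B a p * p = 0 /\ p * B a p * q = (2^-1 * (k - l)) *: (p * a * q).
Proof.
move=> Bpp /triangularP[x [m [y [hx hm hy ->]]]].
have := form_jacobi2 p (x + m + y); rewrite (form_sym BP p) Bpp.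
move: (B _ p) => b; rewrite /ring_commutator => h; split.
  by apply: (eq_by_zero (u := (2^-1 : F) *: q) (v := p) h); nc_ring.
by apply: (eq_by_zero (u := (- 2^-1 : F) *: p) (v := q) h); nc_ring.
Qed.

(** In [B(a,a),p] + 2 [b,a] = 0 with b = B(a,p) the first term has no diagonal blocks. The cross
    terms in the diagonal blocks of [b,a] vanish as qap = 0 and qbp = 0, so the two compressions of
    b are commuting maps on S. *)
Lemma form_p_commuting : exists k l, forall a, triangular a ->
  multiple p (p * B a p * p - k *: (p * a * p)) /\
  multiple q (q * B a p * q - l *: (q * a * q)).
Proof.
have [k0 [l0 Bpp]] := form_pp.
have [k hk] : exists k, forall a, triangular a ->
    multiple p (p * B a p * p - k *: (p * a * p)).
  apply: (split_commuting_p gs (D := triangular) (f := fun a => p * B a p * p)).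
  - exact: triangularD.
  - exact: triangular_pp.
  - by move=> a b; rewrite (formDl BP) mulrDr mulrDl.
  - by move=> a _; exact: (corner_pp pq).
  - move=> a Sa; have [hb _] := form_p_corners Bpp Sa.
    move: (form_jacobi2 a p) hb; rewrite /ring_commutator.
    move: (B a p) => b; have [x [m [y [hx hm hy ->]]]] := triangularP Sa => h hb.
    by apply: (eq_by_zero2 (u := (2^-1 : F) *: p) (v := p) (u' := m) (v' := 1) h hb); nc_ring.
have [l hl] : exists l, forall a, triangular a ->
    multiple q (q * B a p * q - l *: (q * a * q)).
  apply: (split_commuting_q gs (D := triangular) (f := fun a => q * B a p * q)).
  - exact: triangularD.
  - exact: triangular_qq.
  - by move=> a b; rewrite (formDl BP) mulrDr mulrDl.
  - by move=> a _; exact: (corner_qq pq).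
  - move=> a Sa; have [hb _] := form_p_corners Bpp Sa.
    move: (form_jacobi2 a p) hb; rewrite /ring_commutator.
    move: (B a p) => b; have [x [m [y [hx hm hy ->]]]] := triangularP Sa => h hb.
    by apply: (eq_by_zero2 (u := (2^-1 : F) *: q) (v := q) (u' := -1) (v' := m) h hb); nc_ring.
by exists k, l => a Sa; split; auto.
Qed.

Lemma triangular_part_functional e (f : A -> A) : e != 0 ->
  (forall k a b, f (k *: a + b) = k *: f a + f b) ->
  (forall a, triangular a -> multiple e (f a)) ->
  exists2 mu, functional mu & forall a, triangular a -> f a = mu a *: e.
Proof.
(* [f] is controlled on S only; composing it with the projection a |-> a - qap onto S gives a
   functional on all of [A]. *)
move=> e0 flin fe; pose s a := a - q * a * p.
have Ss a : triangular (s a) by rewrite /triangular /s; nc_ring.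
have [mu mulin hmu] : exists2 mu, functional mu & forall a, f (s a) = mu a *: e.
  apply: (functional_choice (P := fun a k => f (s a) = k *: e)) => [a|a k l -> |j a b k l hk hl].
  - exact: fe.
  - exact: scaler_left_inj.
  - have -> : s (j *: a + b) = j *: s a + s b by rewrite /s; nc_ring.
    by rewrite flin hk hl; nc_ring.
exists mu => // a Sa; rewrite -hmu; congr f.
by rewrite /s Sa subr0.
Qed.

Lemma normalize_at_p k0 l0 k l : B p p = k0 *: p + l0 *: q ->
  (forall a, triangular a -> multiple p (p * B a p * p - k *: (p * a * p)) /\
    multiple q (q * B a p * q - l *: (q * a * q))) ->
  exists z mu, functional mu /\ forall a, triangular a -> multiple 1
    (B a p - z *: (a * p + p * a) - mu a *: p - mu p *: a
       - (k + l - k0 + l0) *: (q * a * q)).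
Proof.
move=> Bpp hkl.
have [mu1 mu1lin hmu1] : exists2 mu, functional mu & forall a, triangular a ->
    p * B a p * p - k *: (p * a * p) = mu a *: p.
  apply: (triangular_part_functional (split_p gs)
    (f := fun a => p * B a p * p - k *: (p * a * p))) => [j a b|a /hkl[] //].
  by rewrite (formDl BP) (formZl BP); nc_ring.
have [mu2 mu2lin hmu2] : exists2 mu, functional mu & forall a, triangular a ->
    q * B a p * q - l *: (q * a * q) = mu a *: q.
  apply: (triangular_part_functional (split_q gs)
    (f := fun a => q * B a p * q - l *: (q * a * q))) => [j a b|a /hkl[] //].
  by rewrite (formDl BP) (formZl BP); nc_ring.
have Sp : triangular p by rewrite /triangular; nc_ring.
have mu1p : mu1 p = k0 - k.
  by apply: (scaler_left_inj (split_p gs)); rewrite -hmu1 // Bpp; nc_ring.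
have mu2p : mu2 p = l0.
  by apply: (scaler_left_inj (split_q gs)); rewrite -hmu2 // Bpp; nc_ring.
(* The coefficients of pap and paq vanish when k = 2z + mu(p) and (k0 - l0)/2 = z + mu(p);
   subtracting gives z. Taking mu = mu1 - mu2 leaves the same scalar mu2(a) on both diagonal blocks.
   The coefficient of qaq is then l - mu(p) = k + l - k0 + l0. *)
exists (k - 2^-1 * (k0 - l0)), (fun a => mu1 a - mu2 a); split.
  by move=> j a b; rewrite mu1lin mu2lin; ring.
move=> a Sa; exists (mu2 a); rewrite mu1p mu2p -[X in _ = _ *: X]pq1.
have [b21 b12] := form_p_corners Bpp Sa.
have := hmu1 _ Sa; have := hmu2 _ Sa; move=> /eqP; rewrite subr_eq => /eqP b22.
move=> /eqP; rewrite subr_eq => /eqP b11.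
rewrite [B a p]peirce_decomp1 b11 b12 b21 b22.
have [x [m [y [hx hm hy ->]]]] := triangularP Sa.
by nc_ring.
Qed.

(* The constants k, l above are not unique when pAp or qAq consists of multiples of
   its identity; otherwise the offset d = k + l - k0 + l0 vanishes. *)
Lemma offset_zero d : (forall a, triangular a -> multiple 1 (B a p - d *: (q * a * q))) ->
  [\/ d = 0, forall x, corner p p x -> multiple p x |
             forall y, corner q q y -> multiple q y].
Proof.
move=> hB; have [->|d0] := eqVneq d 0; first by constructor 1.
have key x y : corner p p x -> corner q q y -> multiple p x \/ multiple q y.
  move=> hx hy.
  suff : multiple p ((2 * d) *: x) \/ multiple q y.
    case=> [h|]; [left|by right].
    by apply: multipleZK h; rewrite mulf_neq0 ?pnatr_eq0.
  set b := B (x + y) (x + y).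
  (* The cyclic identity for x + y, m, p shows that c = B(x + y,m) has pq block -d my. In the pq
     block of [b,m] + 2 [c,x + y] = 0 this gives pbp m - m(qbq + 2d yy) + 2d x m y = 0, the relation
     of [split_linked2]. *)
  apply: (split_linked2 gs (corner_pp pq b)
    (y := - (q * b * q + (2 * d) *: (y * y)))) => //.
  - by split; nc_ring.
  - by split; nc_ring.
  move=> m hm.
  have [k hk] := hB _ (triangular_pq hm).
  have [l hl] : multiple 1 (B (x + y) p - d *: (q * (x + y) * q)).
    by apply: hB; rewrite /triangular; nc_ring.
  have Bmp : B m p = k *: 1 by rewrite -hk; nc_ring.
  have Byp : B p (x + y) = l *: 1 + d *: y by rewrite (form_sym BP) -hl; nc_ring.
  have := form_jacobi BP (x + y) m p; rewrite Bmp Byp /ring_commutator => h.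
  have := form_jacobi2 (x + y) m; rewrite -/b /ring_commutator.
  move: h; move: (B (x + y) m) => c h h2.
  apply: (eq_by_zero (u := p) (v := q) h2).
  by apply: (eq_by_zero2 (u := (2 : F) *: p) (v := y) (u' := -((2 : F) *: x)) (v' := q) h h); nc_ring.
have [hp|] := pselect (forall x, corner p p x -> multiple p x); first by constructor 2.
move=> /existsNP[x /not_implyP[hx nx]]; constructor 3 => y hy.
by have [] := key x y hx hy.
Qed.

End Form.

Definition reduced_form (B : A -> A -> A) z mu x y : A :=
  B x y - z *: (x * y + y * x) - mu x *: y - mu y *: x.

Lemma normalized_form (B : A -> A -> A) : commuting_form B ->
  exists z mu, functional mu /\
    forall a, triangular a -> multiple 1 (reduced_form B z mu a p).
Proof.
move=> BP; have [k0 [l0 Bpp]] := form_pp BP.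
suff [k [l [kl hkl]]] : exists k l, k + l - k0 + l0 = 0 /\ forall a, triangular a ->
    multiple p (p * B a p * p - k *: (p * a * p)) /\
    multiple q (q * B a p * q - l *: (q * a * q)).
  have [z [mu [mulin h]]] := normalize_at_p BP Bpp hkl.
  by exists z, mu; split=> // a /h; rewrite kl scale0r subr0.
have [k [l hkl]] := form_p_commuting BP.
have [z [mu [mulin h]]] := normalize_at_p BP Bpp hkl.
have [d0|allp|allq] := offset_zero (commuting_form_sub z BP mulin) h.
- by exists k, l.
(* Here pAp consists of multiples of p, so any k is admissible and the one that cancels the offset
   is taken; the last case does the same with l. *)
- exists (k0 - l0 - l), l; split; first by ring.
  move=> a /hkl[_ ?]; split=> //; apply: allp.
  by have := corner_pp pq (B a p - (k0 - l0 - l) *: a); congr (corner p p _); nc_ring.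
- exists k, (k0 - l0 - k); split; first by ring.
  move=> a /hkl[? _]; split=> //; apply: allq.
  by have := corner_qq pq (B a p - (k0 - l0 - k) *: a); congr (corner q q _); nc_ring.
Qed.

(** * Scalar values of the normalized form on the triangular subalgebra *)

Section Normalized.
Variable B : A -> A -> A.
Hypothesis BP : commuting_form B.
Hypothesis Bp : forall a, triangular a -> multiple 1 (B a p).

(** In the cyclic identity with third argument p the other two commutators have a scalar first
    entry, so B(a,b) commutes with p. *)
Lemma normalized_diagonal a b : triangular a -> triangular b ->
  B a b = p * B a b * p + q * B a b * q.
Proof.
move=> Sa Sb; rewrite [LHS]peirce_decomp1.
have [k hk] := Bp Sb; have [l hl] := Bp Sa.
have := form_jacobi BP a b p; rewrite hk (form_sym BP p) hl /ring_commutator => h.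
by apply: (eq_by_zero2 (u := -p) (v := q) (u' := q) (v' := p) h h); nc_ring.
Qed.


Lemma triangular_pp_qq x y : corner p p x -> corner q q y -> triangular (x + y).
Proof. by move=> hx hy; rewrite /triangular; nc_ring. Qed.

(** The third term [B(m,n),x + y] of the cyclic identity is block diagonal, while the two terms kept
    lie in pAq. *)
Lemma normalized_pq_commutator x y m n : corner p p x -> corner q q y ->
  corner p q m -> corner p q n ->
  comm (B (x + y) m) n + comm (B (x + y) n) m = 0.
Proof.
move=> hx hy hm hn.
have Sa := triangular_pp_qq hx hy.
have Smm := triangular_pq hm; have Snn := triangular_pq hn.
have := form_jacobi BP (x + y) m n; rewrite (form_sym BP n).
rewrite (normalized_diagonal Sa Smm) (normalized_diagonal Sa Snn).
rewrite (normalized_diagonal Smm Snn).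
move: (B _ m) (B _ n) (B m n) => b c d; rewrite /ring_commutator => h.
by apply: (eq_by_zero (u := p) (v := q) h); nc_ring.
Qed.

(** In the cyclic identity with m in pAq, only the commutator of this value with m has a pq block,
    so the value commutes with pAq and the link applies. *)
Lemma normalized_diagonal_diagonal x y x' y' : corner p p x -> corner q q y ->
  corner p p x' -> corner q q y' -> multiple 1 (B (x + y) (x' + y')).
Proof.
move=> hx hy hx' hy'.
have Sa := triangular_pp_qq hx hy; have Sb := triangular_pp_qq hx' hy'.
have : exists k, p * B (x + y) (x' + y') * p = k *: p /\
    q * B (x + y) (x' + y') * q = k *: q.
  apply: (split_linked gs (corner_pp pq _) (corner_qq pq _)) => m hm.
  have Smm := triangular_pq hm.
  have := form_jacobi BP (x + y) (x' + y') m; rewrite (form_sym BP m).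
  rewrite (normalized_diagonal Sa Smm) (normalized_diagonal Sb Smm).
  move: (B _ m) (B _ m) (B _ _) => b c d; rewrite /ring_commutator => h.
  by apply: (eq_by_zero (u := p) (v := q) h); nc_ring.
case=> k [h1 h2]; rewrite (normalized_diagonal Sa Sb) h1 h2; exact: multiple_1.
Qed.

(** B(a,a) and B(a,m) are block diagonal, so the diagonal blocks of [B(a,a),m] + 2 [B(a,m),a] = 0
    say that both compressions of B(a,m) are commuting. *)
Lemma normalized_commuting m : corner p q m -> exists k l, forall a, triangular a ->
  multiple p (p * B a m * p - k *: (p * a * p)) /\
  multiple q (q * B a m * q - l *: (q * a * q)).
Proof.
move=> hm; have Smm := triangular_pq hm.
have [k hk] : exists k, forall a, triangular a ->
    multiple p (p * B a m * p - k *: (p * a * p)).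
  apply: (split_commuting_p gs (D := triangular) (f := fun a => p * B a m * p)).
  - exact: triangularD.
  - exact: triangular_pp.
  - by move=> a b; rewrite (formDl BP) mulrDr mulrDl.
  - by move=> a _; exact: (corner_pp pq).
  - move=> a Sa; move: (form_jacobi2 BP a m).
    rewrite (normalized_diagonal Sa Smm) (normalized_diagonal Sa Sa).
    move: (B a m) (B a a) => b c; have [x [n [y [hx hn hy ->]]]] := triangularP Sa.
    rewrite /ring_commutator => h.
    by apply: (eq_by_zero (u := (2^-1 : F) *: p) (v := p) h); nc_ring.
have [l hl] : exists k, forall a, triangular a ->
    multiple q (q * B a m * q - k *: (q * a * q)).
  apply: (split_commuting_q gs (D := triangular) (f := fun a => q * B a m * q)).
  - exact: triangularD.
  - exact: triangular_qq.
  - by move=> a b; rewrite (formDl BP) mulrDr mulrDl.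
  - by move=> a _; exact: (corner_qq pq).
  - move=> a Sa; move: (form_jacobi2 BP a m).
    rewrite (normalized_diagonal Sa Smm) (normalized_diagonal Sa Sa).
    move: (B a m) (B a a) => b c; have [x [n [y [hx hn hy ->]]]] := triangularP Sa.
    rewrite /ring_commutator => h.
    by apply: (eq_by_zero (u := (2^-1 : F) *: q) (v := q) h); nc_ring.
by exists k, l => a Sa; split; auto.
Qed.

Lemma multiple_1_of_corners b m : corner p q m -> m != 0 ->
  b = p * b * p + q * b * q -> multiple p (p * b * p) -> multiple q (q * b * q) ->
  comm b m = 0 -> multiple 1 b.
Proof.
move=> hm m0 bE [k hk] [l hl]; rewrite bE hk hl /ring_commutator => h.
have : (k - l) *: m = 0 by apply: (eq_by_zero (u := 1) (v := 1) h); nc_ring.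
by move=> /(scaler_inj0 m0)/eqP; rewrite subr_eq0 => /eqP ->; exact: multiple_1.
Qed.

(** So far B(x,m) = kx + lp + jq. If its p block is scalar, commuting with m yields l = j; the work
    lies in excluding the term kx for nonscalar x. *)
Lemma normalized_pp_pq x m : corner p p x -> corner p q m -> multiple 1 (B x m).
Proof.
move=> hx hm; have Sx := triangular_pp hx; have Smm := triangular_pq hm.
have [->|m0] := eqVneq m 0; first by rewrite (form0r BP); exact: multiple0.
have h0 : corner q q 0 by split; rewrite ?mulr0 ?mul0r.
have comm0 m' n : corner p q m' -> corner p q n ->
    comm (B x m') n + comm (B x n) m' = 0.
  by move=> hm' hn; have := normalized_pq_commutator hx h0 hm' hn; rewrite addr0.
have comm_diag n : corner p q n -> comm (B x n) n = 0.
  move=> hn; have h := comm0 _ _ hn hn.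
  by apply: (eq_by_zero (u := (2^-1 : F) *: 1) (v := 1) h); rewrite /ring_commutator; nc_ring.
have corners n : corner p q n -> exists k l j,
    p * B x n * p = k *: x + l *: p /\ q * B x n * q = j *: q.
  move=> hn; have [k [l hkl]] := normalized_commuting hn.
  have [[i hi] [j hj]] := hkl _ Sx.
  exists k, i, j; split.
    by rewrite -hi; nc_ring.
  by rewrite -hj; nc_ring.
have [k [l [j [h1 h2]]]] := corners _ hm.
apply: (multiple_1_of_corners hm m0 (normalized_diagonal Sx Smm)).
- have [//|] := pselect (multiple p (p * B x m * p)) => nx.
  (* Since x n is not a multiple of n, the relation [B x m, n] = - [B x n, m] kills
     the coefficient of x in B x m, first for m = n. *)
  have /existsNP[n] : ~ forall n, corner p q n -> multiple n (x * n).
    move=> /(split_left gs hx)[i xi]; apply: nx; exists (k * i + l).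
    by rewrite h1 xi; nc_ring.
  move=> /not_implyP[hn nn].
  have n0 : n != 0 by apply/eqP => n0; apply: nn; rewrite n0 mulr0; exact: multiple0.
  (* [b,n] = 0 reads k' xn = (j' - l') n, so a nonzero k' would make xn a multiple of n. *)
  have zero b k' l' j' : b = p * b * p + q * b * q -> p * b * p = k' *: x + l' *: p ->
      q * b * q = j' *: q -> comm b n = 0 -> k' = 0.
    move=> bE pb qb; rewrite bE pb qb /ring_commutator => h; apply/eqP/negP => /negP k0.
    apply: nn; apply: (multipleZK k0); exists (j' - l').
    by apply: (eq_by_zero (u := 1) (v := 1) h); nc_ring.
  have Snn := triangular_pq hn.
  have Bn : multiple 1 (B x n).
    have [k' [l' [j' [h1' h2']]]] := corners _ hn.
    apply: (multiple_1_of_corners hn n0 (normalized_diagonal Sx Snn)).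
    - have k0 := zero _ _ _ _ (normalized_diagonal Sx Snn) h1' h2' (comm_diag _ hn).
      by exists l'; rewrite h1' k0 scale0r add0r.
    - by exists j'.
    - exact: comm_diag.
  have := comm0 _ _ hm hn; rewrite (commutator_multiple1 _ Bn) addr0 => h.
  have k0 := zero _ _ _ _ (normalized_diagonal Sx Smm) h1 h2 h.
  by case: nx; exists l; rewrite h1 k0 scale0r add0r.
- by exists j.
- exact: comm_diag.
Qed.

(** The mirror image of the previous argument: the test element n is now one for which ny is not a
    multiple of n. *)
Lemma normalized_qq_pq y m : corner q q y -> corner p q m -> multiple 1 (B y m).
Proof.
move=> hy hm; have Sy := triangular_qq hy; have Smm := triangular_pq hm.
have [->|m0] := eqVneq m 0; first by rewrite (form0r BP); exact: multiple0.
have h0 : corner p p 0 by split; rewrite ?mulr0 ?mul0r.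
have comm0 m' n : corner p q m' -> corner p q n ->
    comm (B y m') n + comm (B y n) m' = 0.
  by move=> hm' hn; have := normalized_pq_commutator h0 hy hm' hn; rewrite add0r.
have comm_diag n : corner p q n -> comm (B y n) n = 0.
  move=> hn; have h := comm0 _ _ hn hn.
  by apply: (eq_by_zero (u := (2^-1 : F) *: 1) (v := 1) h); rewrite /ring_commutator; nc_ring.
have corners n : corner p q n -> exists k l j,
    q * B y n * q = k *: y + l *: q /\ p * B y n * p = j *: p.
  move=> hn; have [l [k hkl]] := normalized_commuting hn.
  have [[j hj] [i hi]] := hkl _ Sy.
  exists k, i, j; split.
    by rewrite -hi; nc_ring.
  by rewrite -hj; nc_ring.
have [k [l [j [h1 h2]]]] := corners _ hm.
apply: (multiple_1_of_corners hm m0 (normalized_diagonal Sy Smm)).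
- by exists j.
- have [//|] := pselect (multiple q (q * B y m * q)) => ny.
  have /existsNP[n] : ~ forall n, corner p q n -> multiple n (n * y).
    move=> /(split_right gs hy)[i yi]; apply: ny; exists (k * i + l).
    by rewrite h1 yi; nc_ring.
  move=> /not_implyP[hn nn].
  have n0 : n != 0 by apply/eqP => n0; apply: nn; rewrite n0 mul0r; exact: multiple0.
  have zero b k' l' j' : b = p * b * p + q * b * q -> q * b * q = k' *: y + l' *: q ->
      p * b * p = j' *: p -> comm b n = 0 -> k' = 0.
    move=> bE pb qb; rewrite bE pb qb /ring_commutator => h; apply/eqP/negP => /negP k0.
    apply: nn; apply: (multipleZK k0); exists (j' - l').
    by apply: (eq_by_zero (u := -1) (v := 1) h); nc_ring.
  have Snn := triangular_pq hn.
  have Bn : multiple 1 (B y n).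
    have [k' [l' [j' [h1' h2']]]] := corners _ hn.
    apply: (multiple_1_of_corners hn n0 (normalized_diagonal Sy Snn)).
    - by exists j'.
    - have k0 := zero _ _ _ _ (normalized_diagonal Sy Snn) h1' h2' (comm_diag _ hn).
      by exists l'; rewrite h1' k0 scale0r add0r.
    - exact: comm_diag.
  have := comm0 _ _ hm hn; rewrite (commutator_multiple1 _ Bn) addr0 => h.
  have k0 := zero _ _ _ _ (normalized_diagonal Sy Smm) h1 h2 h.
  by case: ny; exists l; rewrite h1 k0 scale0r add0r.
- exact: comm_diag.
Qed.

(** For m = n the blocks are scalar at once because pmp = qmq = 0, and 3 [B(m,m),m] = 0 makes the
    scalars agree; polarization gives the rest. *)
Lemma normalized_pq_pq m n : corner p q m -> corner p q n -> multiple 1 (B m n).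
Proof.
have sq m' : corner p q m' -> multiple 1 (B m' m').
  move=> hm; have Smm := triangular_pq hm.
  have [->|m0] := eqVneq m' 0; first by rewrite (form0r BP); exact: multiple0.
  have [k [l /(_ _ Smm)[[i hi] [j hj]]]] := normalized_commuting hm.
  apply: (multiple_1_of_corners hm m0 (normalized_diagonal Smm Smm)).
  - by exists i; rewrite -hi; nc_ring.
  - by exists j; rewrite -hj; nc_ring.
  - have := form_jacobi2 BP m' m'; rewrite /ring_commutator => h.
    by apply: (eq_by_zero (u := (3^-1 : F) *: 1) (v := 1) h); nc_ring.
move=> hm hn; have hmn : corner p q (m + n) by split; nc_ring.
have : multiple 1 ((2 : F) *: B m n).
  have -> : (2 : F) *: B m n = B (m + n) (m + n) + -1 *: B m m + -1 *: B n n.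
    by rewrite !(formDl BP, formDr BP) (form_sym BP n m); nc_ring.
  by do ?apply: multipleD; try apply: multipleZ; exact: sq.
by apply: multipleZK; rewrite pnatr_eq0.
Qed.

Lemma normalized_triangular a b : triangular a -> triangular b -> multiple 1 (B a b).
Proof.
move=> /triangularP[x [m [y [hx hm hy ->]]]] /triangularP[x' [m' [y' [hx' hm' hy' ->]]]].
rewrite addrAC (addrAC x') (formDl BP (x + y)) !(formDr BP _ (x' + y')).
rewrite (formDl BP x y m') (form_sym BP m (x' + y')) (formDl BP x' y' m).
apply: multipleD; first apply: multipleD.
- exact: normalized_diagonal_diagonal.
- by apply: multipleD; [exact: normalized_pp_pq | exact: normalized_qq_pq].
- apply: multipleD; last exact: normalized_pq_pq.
  by apply: multipleD; [exact: normalized_pp_pq | exact: normalized_qq_pq].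
Qed.

End Normalized.


(** * From the triangular subalgebra to the whole algebra *)

Lemma scaler_p_eq1 k l : k *: p = l *: 1 -> k = 0.
Proof.
move=> h; have hq : l *: q = 0.
  have <- : q * (l *: 1) = l *: q by nc_ring.
  by rewrite -h; nc_ring.
move: h; rewrite (scaler_inj0 (split_q gs) hq) scale0r; exact: scaler_inj0 (split_p gs).
Qed.

Lemma multiple_1_of_commutes c : (forall a, triangular a -> c * a = a * c) -> multiple 1 c.
Proof.
move=> cS; have cp : c * p - p * c = 0.
  by rewrite cS ?subrr //; rewrite /triangular; nc_ring.
have : exists k, p * c * p = k *: p /\ q * c * q = k *: q.
  apply: (split_linked gs (corner_pp pq _) (corner_qq pq _)) => m hm.
  have h : c * m - m * c = 0 by rewrite cS ?subrr //; exact: triangular_pq.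
  by apply: (eq_by_zero (u := p) (v := q) h); nc_ring.
case=> k [h1 h2]; exists k; rewrite [c]peirce_decomp1 h1 h2 -pq1.
by apply: (eq_by_zero2 (u := - p) (v := q) (u' := q) (v' := p) cp cp); nc_ring.
Qed.

Lemma extend_from_triangular (B : A -> A -> A) : commuting_form B ->
  (forall a b, triangular a -> triangular b -> multiple 1 (B a b)) ->
  exists2 mu, functional mu &
    forall a b, multiple 1 (B a b - mu a *: b - mu b *: a).
Proof.
move=> BP hB.
have Sp : triangular p by rewrite /triangular; nc_ring.
have [mu mulin hmu] : exists2 mu, functional mu & forall a s, triangular s ->
    multiple 1 (B s (q * a * p) - mu a *: s).
  apply: (functional_choice (P := fun a k => forall s, triangular s ->
    multiple 1 (B s (q * a * p) - k *: s))) => [a|a k l hk hl|j a b k l hk hl s Ss].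
  (* Taken with p + q = 1 and domain S. As B(s,s) is scalar, [B(s,s),t] + 2 [B(s,t),s] = 0 reduces
     to the commuting condition for s |-> B(s,t), t = qap. *)
  - have := @commuting_map_sum _ _ _ _ pq triangular (fun s => B s (q * a * p))
      (split_linked gs) (split_central_p gs) (split_central_q gs) triangularD
      triangular_pp triangular_qq triangular_pq.
    rewrite pq1 => h.
    have [|s _|s Ss|k hk] := h.
    + by move=> s t; rewrite (formDl BP).
    + by split; rewrite ?mul1r ?mulr1.
    + have := form_jacobi2 BP s (q * a * p).
      rewrite (commutator_multiple1 _ (hB _ _ Ss Ss)) /ring_commutator => h2.
      by apply: (eq_by_zero (u := (2^-1 : F) *: 1) (v := 1) h2); nc_ring.
    + by exists k => s /hk; rewrite mul1r mulr1.
  (* Two candidates are compared at s = p: their difference times p is scalar, and p is not. *)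
  - have [i hi] := hk _ Sp; have [j hj] := hl _ Sp.
    apply/eqP; rewrite -subr_eq0; apply/eqP; apply: (@scaler_p_eq1 _ (j - i)).
    have -> : (k - l) *: p = (B p (q * a * p) - l *: p) - (B p (q * a * p) - k *: p).
      by nc_ring.
    by rewrite hi hj scalerBl.
  - have [i hi] := hk _ Ss; have [i' hi'] := hl _ Ss.
    exists (j * i + i').
    have -> : q * (j *: a + b) * p = j *: (q * a * p) + q * b * p by nc_ring.
    rewrite (formDr BP) (formZr BP).
    transitivity (j *: (B s (q * a * p) - k *: s) + (B s (q * b * p) - l *: s)).
      by nc_ring.
    by rewrite hi hi'; nc_ring.
have mu0 a : triangular a -> mu a = 0.
  move=> Sa; have := hmu a _ Sp; rewrite Sa (form0r BP) sub0r => -[k].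
  move=> h; apply: (@scaler_p_eq1 _ (- k)).
  by rewrite -[LHS]opprK h scaleNr.
exists mu => //.
pose B' x y := B x y - mu x *: y - mu y *: x.
have B'P : commuting_form B'.
  have := commuting_form_sub 0 BP mulin; congr commuting_form.
  by apply/funext => x; apply/funext => y; rewrite /B' scale0r subr0.
have SS a b : triangular a -> triangular b -> multiple 1 (B' a b).
  by move=> Sa Sb; rewrite /B' !mu0 // !scale0r !subr0; exact: hB.
have ST s a : triangular s -> multiple 1 (B' s (q * a * p)).
  move=> Ss; rewrite /B' (mu0 _ Ss) scale0r subr0.
  have -> : mu (q * a * p) = mu a; last exact: hmu.
  have -> : q * a * p = -1 *: (a - q * a * p) + a by nc_ring.
  by rewrite mulin mu0 ?mulr0 ?add0r //; rewrite /triangular; nc_ring.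
have TT a b : multiple 1 (B' (q * a * p) (q * b * p)).
  (* Against s in S, two terms of the cyclic identity have a scalar first entry by [ST], so this
     value commutes with S. *)
  apply: multiple_1_of_commutes => s Ss; apply/eqP; rewrite -subr_eq0; apply/eqP.
  have := form_jacobi B'P (q * a * p) (q * b * p) s.
  rewrite (form_sym B'P (q * b * p) s).
  by rewrite !(commutator_multiple1 _ (ST _ _ Ss)) !addr0.
move=> a b; rewrite -/(B' a b).
pose t x := x - q * x * p; have St x : triangular (t x) by rewrite /triangular /t; nc_ring.
have tE x : x = t x + q * x * p by rewrite subrK.
rewrite (tE a) (tE b) (formDl B'P) !(formDr B'P _ (t b)).
rewrite (form_sym B'P (q * a * p) (t b)).
by do 2?apply: multipleD; auto.
Qed.

Theorem commuting_form_standard (B : A -> A -> A) : commuting_form B ->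
  exists z mu, functional mu /\
    forall a b, multiple 1 (B a b - z *: (a * b + b * a) - mu a *: b - mu b *: a).
Proof.
move=> BP; have [z [mu [mulin hmu]]] := normalized_form BP.
have B'P := commuting_form_sub z BP mulin.
have [mu' mu'lin hmu'] := extend_from_triangular B'P (normalized_triangular B'P hmu).
exists z, (fun a => mu a + mu' a); split.
  by move=> k a b; rewrite mulin mu'lin; ring.
move=> a b; have := hmu' a b; congr multiple; nc_ring.
Qed.

End GoodSplitting.
End CommutingForms.

(** * Orthogonal projections *)

Import numFieldNormedType.Exports.

Local Open Scope classical_set_scope.
Local Open Scope complex_scope.

Section InnerProduct.
Context {R : realType} {H : hilbertType R}.
Implicit Types (x y v w : H).

Definition ip x y : R[i] := inner x y.

Lemma ipC x y : ip x y = (ip y x)^*%R.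
Proof. by have := hermC (inner : {dot H for _}) x y; rewrite expr0 mul1r. Qed.

Lemma ipDl x y v : ip (x + y) v = ip x v + ip y v.
Proof. exact: (linearDl (inner : {dot H for _})). Qed.

Lemma ipBl x y v : ip (x - y) v = ip x v - ip y v.
Proof. exact: (linearBl (inner : {dot H for _})). Qed.

Lemma ipZl (k : R[i]) x v : ip (k *: x) v = k * ip x v.
Proof. exact: (linearZl_LR (inner : {dot H for _})). Qed.

Lemma ipDr x y v : ip v (x + y) = ip v x + ip v y.
Proof. by rewrite ipC ipDl rmorphD /= -!ipC. Qed.

Lemma ipBr x y v : ip v (x - y) = ip v x - ip v y.
Proof. by rewrite ipC ipBl rmorphB /= -!ipC. Qed.

Lemma ipZr (k : R[i]) x v : ip v (k *: x) = k^*%R * ip v x.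
Proof. by rewrite ipC ipZl rmorphM /= -!ipC. Qed.

Lemma ip0l x : ip 0 x = 0.
Proof. by rewrite -(scale0r x) ipZl mul0r. Qed.

Lemma ip0r x : ip x 0 = 0.
Proof. by rewrite ipC ip0l rmorph0. Qed.

Lemma ip_norm x : ip x x = `|x| ^+ 2.
Proof. exact: inner_norm. Qed.

Lemma ip_eq0 x : (ip x x == 0) = (x == 0).
Proof. by rewrite ip_norm expf_eq0 /= normr_eq0. Qed.

Lemma ip_ge0 x : 0 <= ip x x.
Proof. by rewrite ip_norm exprn_ge0. Qed.

Lemma ip_eq0C x y : ip x y = 0 -> ip y x = 0.
Proof. by rewrite ipC => /eqP; rewrite conjC_eq0 => /eqP. Qed.

Lemma ip_subZ_norm x y : y != 0 ->
  `|x - (ip x y / ip y y) *: y| ^+ 2 = `|x| ^+ 2 - `|ip x y| ^+ 2 / `|y| ^+ 2.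
Proof.
move=> y0; have yy0 : ip y y != 0 by rewrite ip_eq0.
rewrite -!ip_norm ipBl !ipBr !ipZl !ipZr (ipC y x) rmorphM /= fmorphV /=.
by rewrite (geC0_conj (ip_ge0 y)) normCK; field.
Qed.

Lemma ip_sub_proj x y : y != 0 -> ip (x - (ip x y / ip y y) *: y) y = 0.
Proof. by move=> y0; rewrite ipBl ipZl divfK ?subrr // ip_eq0. Qed.

Lemma cauchy_schwarz x y : `|ip x y| <= `|x| * `|y|.
Proof.
have [->|y0] := eqVneq y 0; first by rewrite ip0r !normr0 mulr0.
have yy0 : 0 < `|y| ^+ 2 by rewrite exprn_gt0 ?normr_gt0.
rewrite -ler_sqr ?nnegrE ?mulr_ge0 ?normr_ge0 // exprMn -ler_pdivrMr //.
by rewrite -subr_ge0 -ip_subZ_norm // exprn_ge0.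
Qed.

Lemma parallelogram x y :
  `|x + y| ^+ 2 + `|x - y| ^+ 2 = 2 * `|x| ^+ 2 + 2 * `|y| ^+ 2.
Proof.
by rewrite -!ip_norm ipDl ipBl !ipBr !ipDr; ring.
Qed.

End InnerProduct.

Section Projection.
Context {R : realType} {H : hilbertType R}.
Implicit Types (x y v w : H).

Section NearestPoint.
Variables (M : set H) (v : H).
Hypothesis M_lin : linear_subspace M.
Variable D : R.
Hypothesis D_lb : forall w, M w -> D%:C <= `|v - w| ^+ 2.

(** Parallelogram law: the midpoint of u1 and u2 lies in M, so its squared distance to v is at least
    D. *)
Lemma near_minimizer_dist u1 u2 (e1 e2 : R) : M u1 -> M u2 ->
  `|v - u1| ^+ 2 < (D + e1)%:C -> `|v - u2| ^+ 2 < (D + e2)%:C ->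
  `|u1 - u2| ^+ 2 < (2 * (e1 + e2))%:C.
Proof.
move=> M1 M2 h1 h2; have [M0 ML] := M_lin.
have Mm : M ((2^-1 : R[i]) *: (u1 + u2)).
  rewrite -[X in M X]addr0; apply: (ML _ _ _ _ M0).
  by rewrite -[u1]scale1r; apply: (ML _ _ _ M1 M2).
have := D_lb Mm; have := parallelogram (v - u1) (v - u2).
have -> : v - u1 - (v - u2) = - (u1 - u2) by rewrite opprB addrC addrA subrK opprB.
have -> : v - u1 + (v - u2) = (2 : R[i]) *: (v - (2^-1 : R[i]) *: (u1 + u2)).
  rewrite scalerBr scalerA mulfV ?pnatr_eq0 // scale1r scaler_nat mulr2n opprD.
  by rewrite addrACA.
rewrite normrN normrZ exprMn ger0_norm // => hp hD.
have hp' : `|u1 - u2| ^+ 2 = 2 * `|v - u1| ^+ 2 + 2 * `|v - u2| ^+ 2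
    - 2 ^+ 2 * `|v - (2^-1 : R[i]) *: (u1 + u2)| ^+ 2 by rewrite -hp; ring.
rewrite hp'.
have -> : (2 * (e1 + e2))%:C = 2 * (D + e1)%:C + 2 * (D + e2)%:C - 2 ^+ 2 * D%:C :> R[i].
  by rewrite !(rmorphM, rmorphD) /=; ring.
apply: ltr_leB; last by rewrite ler_pM2l // exprn_gt0.
by apply: ltrD; rewrite ltr_pM2l.
Qed.

(** Correcting u along w lowers the squared distance by |<v - u,w>|^2 / |w|^2 and cannot bring it
    below D. *)
Lemma near_minimizer_orth u w (e : R) : M u -> M w ->
  `|v - u| ^+ 2 < (D + e)%:C -> `|ip (v - u) w| ^+ 2 <= e%:C * `|w| ^+ 2.
Proof.
move=> Mu Mw hu; have [->|w0] := eqVneq w 0.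
  by rewrite ip0r normr0 expr0n /= normr0 expr0n mulr0.
have [M0 ML] := M_lin.
have := D_lb (ML (ip (v - u) w / ip w w) w u Mw Mu).
have -> : v - (ip (v - u) w / ip w w *: w + u)
    = v - u - (ip (v - u) w / ip w w) *: w by rewrite opprD addrA addrAC.
rewrite ip_subZ_norm // => h.
have ww : 0 < `|w| ^+ 2 by rewrite exprn_gt0 ?normr_gt0.
rewrite -ler_pdivrMr //; move: h; rewrite lerBrDl => h.
have := le_lt_trans h hu; rewrite rmorphD /= addrC ltrD2l.
exact: ltW.
Qed.

End NearestPoint.

Lemma exists_projection (M : set H) v : closed_subspace M ->
  exists u, M u /\ forall w, M w -> ip (v - u) w = 0.
Proof.
move=> [Mlin Mclosed]; have [M0 ML] := Mlin.
(* Norms take values in [R[i]]; the infimum is formed over their real preimages. *)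
pose E := [set r : R | exists2 w, M w & r%:C = `|v - w| ^+ 2].
have EP w : M w -> exists2 r, E r & r%:C = `|v - w| ^+ 2.
  move=> Mw; have /RRe_real h : `|v - w| ^+ 2 \is Num.real by rewrite ger0_real ?exprn_ge0.
  by exists (complex.Re (`|v - w| ^+ 2)); [exists w|].
have E0 : lbound E 0 by move=> r [w _ h]; rewrite -ler0c h exprn_ge0.
have Einf : has_inf E by split; [have [r Er _] := EP _ M0; exists r | exists 0].
pose D := inf E.
have D_lb w : M w -> D%:C <= `|v - w| ^+ 2.
  by move=> /EP[r Er <-]; rewrite lecR; apply: ge_inf Er; exists 0.
have : forall n, exists u, M u /\ `|v - u| ^+ 2 < (D + n.+1%:R^-1)%:C.
  move=> n; have n0 : 0 < (n.+1%:R^-1 : R) by rewrite invr_gt0.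
  have [r [u Mu ru] rD] := inf_adherent n0 Einf.
  by exists u; split=> //; rewrite -ru ltcR.
move=> /choice[u_ hu].
have small (e : R) : 0 < e -> \forall n \near \oo, (n.+1%:R^-1 : R) < e.
  by move=> e0; exact: (near_infty_natSinv_lt (PosNum e0)).
have : cvg (u_ @ \oo).
  apply/cauchy_cvgP/cauchy_exP => e e0.
  have eR : e = (complex.Re e)%:C by rewrite RRe_real // gtr0_real.
  have re0 : 0 < complex.Re e by rewrite -ltcR -eR.
  (* Two errors below e^2 / 4 give a squared distance below 2 (e^2/4 + e^2/4) = e^2. *)
  have r4 : 0 < complex.Re e ^+ 2 / 4 by rewrite divr_gt0 // exprn_gt0.
  have [N _ hN] := small _ r4.
  exists (u_ N); exists N => // n /= Nn; rewrite -ball_normE /=.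
  have [MN uN] := hu N; have [Mn un] := hu n.
  have nN := hN _ Nn; have NN := hN N (leqnn N); move: nN NN => /= nN NN.
  rewrite -ltr_sqr ?nnegrE ?normr_ge0 ?(ltW e0) //.
  apply: lt_trans (near_minimizer_dist Mlin D_lb MN Mn uN un) _.
  rewrite eR -rmorphXn /= ltcR.
  move: (n.+1%:R^-1 : R) (N.+1%:R^-1 : R) (complex.Re e ^+ 2) nN NN => a b c; lra.
move=> /cvg_ex[u uE]; exists u; split.
  by apply: (closed_cvg M Mclosed _ u uE); apply: nearW => n; have [] := hu n.
move=> w Mw; apply/eqP; rewrite -normr_eq0; apply/negP => /negP a0.
have {a0}a0 : 0 < `|ip (v - u) w| by rewrite lt_def a0 normr_ge0.
have w0 : 0 < `|w|.
  by rewrite normr_gt0; apply/eqP => w0; move: a0; rewrite w0 ip0r normr0 ltxx.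
(* Two errors of size d|w| add up to half of |<v - u,w>|, a contradiction. *)
pose d := `|ip (v - u) w| / (4 * `|w|).
have d0 : 0 < d by rewrite divr_gt0 // mulr_gt0.
have dR : d = (complex.Re d)%:C by rewrite RRe_real // gtr0_real.
have rd0 : 0 < complex.Re d ^+ 2 by rewrite exprn_gt0 // -ltcR -dR.
move/cvgrPdist_lt : uE => /(_ d d0) uE.
have [n [nd ud]] : exists n, (n.+1%:R^-1 : R) < complex.Re d ^+ 2 /\ `|u - u_ n| < d.
  by apply: (@filter_ex _ \oo); apply: filterI; [exact: small | exact: uE].
have [Mn un] := hu n.
have h1 : `|ip (v - u_ n) w| <= d * `|w|.
  rewrite -ler_sqr ?nnegrE ?mulr_ge0 ?normr_ge0 ?(ltW d0) // exprMn.
  apply: le_trans (near_minimizer_orth Mlin D_lb Mn Mw un) _.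
  by rewrite ler_pM2r ?exprn_gt0 // dR -rmorphXn /= lecR ltW.
have h2 : `|ip (u - u_ n) w| <= d * `|w|.
  by apply: le_trans (cauchy_schwarz _ _) _; rewrite ler_pM2r // ltW.
have : `|ip (v - u) w| <= d * `|w| + d * `|w|.
  have -> : v - u = (v - u_ n) - (u - u_ n) by rewrite opprB addrA subrK.
  by rewrite ipBl; apply: le_trans (ler_normB _ _) (lerD h1 h2).
have -> : d * `|w| + d * `|w| = `|ip (v - u) w| / 2.
  by rewrite /d; field; rewrite gt_eqF.
by rewrite ler_pdivlMr // ger_pMr // (ler_nat _ 2 1).
Qed.

End Projection.

(** * Rank one operators and nest projections *)

(** The algebra structure requires 1 to differ from 0. The alias keeps the witness [h] in the type,
    where the instances below can find it. *)
Definition nz_nest_alg (R : realType) (H : hilbertType R) (N : nest H) (x0 : H)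
  (h : x0 != 0) : Type := nest_alg N.

Section Instances.
Context {R : realType} {H : hilbertType R} (N : nest H) (x0 : H) (h : x0 != 0).
HB.instance Definition _ := GRing.PzRing.on (nz_nest_alg N h).
HB.instance Definition _ := GRing.Lmodule.on (nz_nest_alg N h).

Lemma nz_nest_alg_oner_neq0 : (1 : nz_nest_alg N h) != 0.
Proof.
apply/eqP => /(congr1 (fun T : nest_alg N => T x0)).
by move: h; case: eqP.
Qed.

HB.instance Definition _ :=
  GRing.PzSemiRing_isNonZero.Build (nz_nest_alg N h) nz_nest_alg_oner_neq0.
HB.instance Definition _ :=
  GRing.LSemiModule_isLSemiAlgebra.Build R[i] (nz_nest_alg N h)
    (@nest_alg_scaleAl R H N).
HB.instance Definition _ :=
  GRing.LSemiAlgebra_isSemiAlgebra.Build R[i] (nz_nest_alg N h)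
    (@nest_alg_scaleAr R H N).
End Instances.

Section Operators.
Context {R : realType} {H : hilbertType R} (N : nest H) (x0 : H) (x0_neq0 : x0 != 0).
Local Notation A := (nz_nest_alg N x0_neq0).
Implicit Types (S T p q : A) (x y u v w : H) (k : R[i]).

Definition act T x : H := nest_alg_op (T : nest_alg N) x.
Arguments act : simpl never.

Lemma act_ext S T : (forall x, act S x = act T x) -> S = T.
Proof. by move=> h; apply: val_inj; apply/funext. Qed.

Lemma actM S T x : act (S * T) x = act S (act T x). Proof. by []. Qed.
Lemma actD S T x : act (S + T) x = act S x + act T x. Proof. by []. Qed.
Lemma actZ k T x : act (k *: T) x = k *: act T x. Proof. by []. Qed.
Lemma act1 x : act 1 x = x. Proof. by []. Qed.
Lemma act0 x : act 0 x = 0. Proof. by []. Qed.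
Lemma actN T x : act (- T) x = - act T x. Proof. by rewrite -scaleN1r actZ scaleN1r. Qed.
Lemma actB S T x : act (S - T) x = act S x - act T x. Proof. by rewrite actD actN. Qed.

Lemma act_lin T k x y : act T (k *: x + y) = k *: act T x + act T y.
Proof. exact: (nest_alg_linear (T : nest_alg N) k x y). Qed.

Lemma actx0 T : act T 0 = 0.
Proof. by have := act_lin T (-1) 0 0; rewrite scaler0 addr0 scaleN1r addNr. Qed.

Lemma actxZ T k x : act T (k *: x) = k *: act T x.
Proof. by have := act_lin T k x 0; rewrite actx0 !addr0. Qed.

Lemma actxD T x y : act T (x + y) = act T x + act T y.
Proof. by have := act_lin T 1 x y; rewrite !scale1r. Qed.

Lemma act_bounded T : exists2 C : R, 0 <= C & forall x, `|act T x| <= C%:C * `|x|.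
Proof.
have [[_ [C hC]] _] := set_mem (nest_algP (T : nest_alg N)).
exists `|C| => // x; apply: le_trans (hC x) _; apply: ler_wpM2r => //.
by rewrite lecR ler_norm.
Qed.

Lemma exists_operator (f : H -> H) (C : R) :
  (forall k x y, f (k *: x + y) = k *: f x + f y) ->
  (forall x, `|f x| <= C%:C * `|x|) ->
  (forall M x, nest_set N M -> M x -> M (f x)) ->
  exists T, forall x, act T x = f x.
Proof.
move=> flin fC fN.
have fA : f \in alg_set N.
  by apply/mem_set; split; [split; [exact: flin | exists C] | move=> M NM _ [x Mx <-]; exact: fN].
by exists (NestAlg fA).
Qed.

Lemma nest_closed_lin M k x y : nest_set N M -> M x -> M y -> M (k *: x + y).
Proof. by move=> /nest_subspace[_]; apply. Qed.

Lemma nest_closedZ M k x : nest_set N M -> M x -> M (k *: x).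
Proof.
move=> NM Mx; rewrite -[k *: x]addr0; apply: nest_closed_lin => //.
by case: (nest_subspace NM).
Qed.

(* The maps v |-> ip (q v) w are the bounded functionals that factor through q. *)
Definition full p q : Prop := forall u w, act p u = u ->
  exists T, forall v, act T v = ip (act q v) w *: u.

Lemma rank_one_operator (q : A) u w :
  (forall M v, nest_set N M -> M v -> ip (act q v) w = 0 \/ M u) ->
  exists T : A, forall v, act T v = ip (act q v) w *: u.
Proof.
move=> hM; have [C C0 hC] := act_bounded q.
apply: (@exists_operator _ (complex.Re (C%:C * `|w| * `|u|))).
- by move=> k x y; rewrite act_lin ipDl ipZl scalerDl scalerA.
- move=> x; rewrite RRe_real ?ger0_real ?mulr_ge0 ?ler0c //.
  rewrite normrZ [leRHS]mulrAC; apply: ler_wpM2r => //.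
  apply: le_trans (cauchy_schwarz _ _) _.
  by rewrite [leRHS]mulrAC; apply: ler_wpM2r.
- move=> M v NM Mv; have [->|Mu] := hM M v NM Mv; last exact: nest_closedZ.
  by rewrite scale0r; case: (nest_subspace NM).
Qed.

Lemma full_corner p q u w : p * p = p -> q * q = q -> full p q -> act p u = u ->
  exists2 T, corner p q T & forall v, act T v = ip (act q v) w *: u.
Proof.
move=> pp qq hpq pu; have [T hT] := hpq u w pu; exists T => //.
by split; apply: act_ext => v; rewrite actM !hT ?actxZ ?pu // -actM qq.
Qed.

Lemma exists_range p : p != 0 -> exists2 u, u != 0 & act p u <> 0.
Proof.
move=> p0; apply: contrapT => h; move/eqP: p0; apply; apply: act_ext => x.
rewrite act0; apply: contrapT => px; apply: h; exists x => //.
by apply/eqP => x00; apply: px; rewrite x00 actx0.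
Qed.

Lemma exists_range_idem p : p * p = p -> p != 0 -> exists2 u, u != 0 & act p u = u.
Proof.
move=> pp /exists_range[u _ pu]; exists (act p u); first exact/eqP.
by rewrite -actM pp.
Qed.


(** Eigenvalues at u and v are compared through the one at u + v. *)
Lemma multiple_of_eigen p T : corner p p T -> p * p = p ->
  (forall u, act p u = u -> exists k, act T u = k *: u) -> multiple p T.
Proof.
move=> [pT Tp] pp eig; have [p0|p0] := eqVneq p 0.
  by rewrite -pT p0 mul0r; exact: multiple0.
have [u u0 pu] := exists_range_idem pp p0; have [k hk] := eig u pu.
exists k; apply: act_ext => x; rewrite actZ -Tp actM.
have : act p (act p x) = act p x by rewrite -actM pp.
move: (act p x) => v pv; have [l hl] := eig v pv.
have [->|v0] := eqVneq v 0; first by rewrite actx0 scaler0.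
have [j hj] : exists j, act T (u + v) = j *: (u + v) by apply: eig; rewrite actxD pu pv.
have : (j - k) *: u = (l - j) *: v.
  apply/eqP; rewrite -subr_eq0 !scalerBl opprB addrACA -opprD.
  by move: hj; rewrite actxD hk hl scalerDr => ->; rewrite subrr.
rewrite hl; have [->|jk] := eqVneq j k.
  rewrite subrr scale0r => /esym/eqP; rewrite scaler_eq0 subr_eq0 (negbTE v0) orbF.
  by move=> /eqP ->.
(* Otherwise u is a multiple of v, and the eigenvalues agree for that reason. *)
move=> h; have {h}uv : u = ((j - k)^-1 * (l - j)) *: v.
  by rewrite -scalerA -h scalerA mulVf ?scale1r // subr_eq0.
have : l *: u = k *: u by rewrite -hk [in RHS]uv actxZ hl scalerA mulrC -scalerA -uv.
by move=> /eqP; rewrite -subr_eq0 -scalerBl scaler_eq0 (negbTE u0) orbF subr_eq0 => /eqP ->.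
Qed.

Section FullPair.
Variables p q : A.
Hypotheses (pp : p * p = p) (qq : q * q = q) (p0 : p != 0) (q0 : q != 0).
Hypothesis hpq : full p q.

(** On a rank one m the hypothesis becomes <qy,w> Sx = <Ty,w> x. Fixing y = w = v makes S a scalar
    that does not depend on x; letting w vary then identifies T. *)
Lemma full_linked : linked p q.
Proof.
move=> S T hS hT hST.
have [v v0 qv] := exists_range_idem qq q0; have [u u0 pu] := exists_range_idem pp p0.
have vv : ip v v != 0 by rewrite ip_eq0.
have key x y w : act p x = x -> ip (act q y) w *: act S x = ip (act T y) w *: x.
  move=> px; have [m hm mE] := full_corner w pp qq hpq px.
  have := congr1 (act^~ y) (hST _ hm); rewrite /= !actM !mE actxZ.
  by have [h _] := hT; rewrite -(actM q) h.
have Sx x : act p x = x -> act S x = (ip (act T v) v / ip v v) *: x.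
  by move=> px; rewrite mulrC -scalerA -key // qv scalerA mulVf // scale1r.
exists (ip (act T v) v / ip v v); split; apply: act_ext => y.
  by have [_ h] := hS; rewrite -h actM Sx ?actZ // -actM pp.
set k := _ / _; have h w : ip (act T y - act (k *: q) y) w = 0.
  apply/eqP; have := key u y w pu; rewrite Sx // scalerA => /eqP.
  rewrite -subr_eq0 -scalerBl scaler_eq0 (negbTE u0) orbF actZ ipBl ipZl.
  by rewrite mulrC -/k -oppr_eq0 opprB.
by have /eqP := h (act T y - act (k *: q) y); rewrite ip_eq0 subr_eq0 => /eqP.
Qed.

(** The component w of Tv orthogonal to v satisfies <w,w> = <Tv,w> = 0, so v is an eigenvector. *)
Lemma multiple_q_of_orth T : corner q q T ->
  (forall v w, act q v = v -> ip v w = 0 -> ip (act T v) w = 0) -> multiple q T.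
Proof.
move=> hT orth; apply: multiple_of_eigen => // v qv.
have [->|v0] := eqVneq v 0; first by exists 0; rewrite actx0 scaler0.
exists (ip (act T v) v / ip v v).
set w := act T v - (ip (act T v) v / ip v v) *: v.
have wv : ip w v = 0 by exact: ip_sub_proj.
have : ip w w = 0.
  rewrite {1}/w ipBl ipZl (ip_eq0C wv) mulr0 subr0; apply: orth => //.
  exact: ip_eq0C.
by move=> /eqP; rewrite ip_eq0 subr_eq0 => /eqP.
Qed.

(** If S is not scalar, some Su is no multiple of u. The rank one m built from u and a w orthogonal
    to v, evaluated at v, gives <Yv,w> u + <Tv,w> Su = 0, hence <Tv,w> = 0. *)
Lemma full_linked2 X Y S T : corner p p X -> corner q q Y -> corner p p S -> corner q q T ->
  (forall m, corner p q m -> X * m + m * Y + S * m * T = 0) ->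
  multiple p S \/ multiple q T.
Proof.
move=> hX hY hS hT h; have [|nS] := pselect (multiple p S); [by left | right].
have [u pu nu] : exists2 u, act p u = u & forall k, act S u <> k *: u.
  apply: contrapT => hn; apply: nS; apply: multiple_of_eigen => // u pu.
  by apply: contrapT => nk; apply: hn; exists u => // k hk; apply: nk; exists k.
apply: multiple_q_of_orth => // v w qv vw.
have [m hm mE] := full_corner w pp qq hpq pu.
have := congr1 (act^~ v) (h _ hm); rewrite /= !actD !actM !mE act0 qv vw !actxZ.
have [qY _] := hY; have [qT _] := hT; rewrite -!(actM q) qY qT scale0r add0r => E.
apply/eqP/negP => /negP c0; apply: (nu (- (ip (act T v) w)^-1 * ip (act Y v) w)).
rewrite mulNr scaleNr -scalerA; apply/eqP; rewrite -subr_eq0 opprK addrC.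
rewrite -[X in _ + X](scale1r) -(mulVf c0) -scalerA -scalerDr E scaler0; exact: eqxx.
Qed.

Lemma full_left X : corner p p X ->
  (forall m, corner p q m -> multiple m (X * m)) -> multiple p X.
Proof.
move=> hX h; apply: multiple_of_eigen => // u pu.
have [v v0 qv] := exists_range_idem qq q0.
have vv : ip v v != 0 by rewrite ip_eq0.
have [m hm mE] := full_corner v pp qq hpq pu; have [k hk] := h _ hm.
exists k; have := congr1 (act^~ v) hk; rewrite /= actM actZ mE qv actxZ => E.
by apply: (scalerI vv); rewrite E !scalerA mulrC.
Qed.

Lemma full_right Y : corner q q Y ->
  (forall m, corner p q m -> multiple m (m * Y)) -> multiple q Y.
Proof.
move=> hY h; apply: multiple_q_of_orth => // v w qv vw.
have [u u0 pu] := exists_range_idem pp p0.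
have [m hm mE] := full_corner w pp qq hpq pu; have [k hk] := h _ hm.
have := congr1 (act^~ v) hk; rewrite /= actM actZ !mE qv vw scale0r scaler0.
have [qY _] := hY; rewrite -actM qY => /eqP.
by rewrite scaler_eq0 (negbTE u0) orbF => /eqP.
Qed.

End FullPair.

Lemma full_central_multiple e : e * e = e -> full e e -> central_multiple e.
Proof.
move=> ee hee c hc cc; have [e0|e0] := eqVneq e 0.
  by case: hc => <- _; rewrite e0 mul0r; exact: multiple0.
have [k [-> _]] := full_linked ee ee e0 e0 hee hc hc cc.
by exists k.
Qed.

End Operators.

(** * Intervals of the nest and the existence of a good splitting *)

Section Splittings.
Context {R : realType} {H : hilbertType R} (N : nest H) (x0 : H) (x0_neq0 : x0 != 0).
Local Notation A := (nz_nest_alg N x0_neq0).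
Implicit Types (S T P e p q : A) (x y u v w : H) (k : R[i]) (K L M : set H).

Lemma full_sub e p q : full e e -> e * p = p -> e * q = q -> full p q.
Proof.
move=> hee ep eq u w pu; have eu : act e u = u by rewrite -pu -actM ep.
have [T hT] := hee u w eu; exists (T * q) => v.
by rewrite actM hT -actM eq.
Qed.

Lemma rank_one_idempotent e u : e * e = e -> full e e -> u != 0 -> act e u = u ->
  exists p, [/\ p * p = p, e * p = p, p * e = p, p != 0 &
    forall S, corner p p S -> multiple p S].
Proof.
move=> ee hee u0 eu; have uu : ip u u != 0 by rewrite ip_eq0.
have [p hp] : exists p, forall v, act p v = (ip (act e v) u / ip u u) *: u.
  have eu' : act e ((ip u u)^-1 *: u) = (ip u u)^-1 *: u by rewrite actxZ eu.
  have [T hT] := hee _ u eu'.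
  by exists T => v; rewrite hT scalerA.
have pu : act p u = u by rewrite hp eu divff // scale1r.
exists p; split.
- by apply: act_ext => v; rewrite actM (hp v) actxZ pu.
- by apply: act_ext => v; rewrite actM (hp v) actxZ eu.
- by apply: act_ext => v; rewrite actM !hp -actM ee.
- by apply/eqP => p0; move: pu; rewrite p0 act0 => /esym/eqP; rewrite (negbTE u0).
- move=> S [pS Sp]; exists (ip (act e (act S u)) u / ip u u); apply: act_ext => v.
  have Su : act S u = (ip (act e (act S u)) u / ip u u) *: u by rewrite -hp -actM pS.
  by rewrite actZ -{1}Sp actM hp actxZ {1}Su !scalerA mulrC.
Qed.

Lemma peirce_sub e p : e * e = e -> p * p = p -> e * p = p -> p * e = p ->
  peirce p (e - p).
Proof.
move=> ee pp ep pe; split=> //; rewrite ?mulrBl ?mulrBr ?ee ?pp ?ep ?pe ?subrr //.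
by rewrite subr0.
Qed.

Lemma full_split e : e * e = e -> full e e -> (forall S, corner e e S -> multiple e S) \/
  exists p q, [/\ peirce p q, p + q = e, p != 0, q != 0 &
    [/\ full p q, full q q & forall S, corner p p S -> multiple p S]].
Proof.
move=> ee hee; have [e0|e0] := eqVneq e 0.
  by left=> x [<- _]; rewrite e0 mul0r; exact: multiple0.
have [u u0 eu] := exists_range_idem ee e0.
have [p [pp ep pe p0 hp]] := rank_one_idempotent ee hee u0 eu.
have [ep0|q0] := eqVneq (e - p) 0.
  by left; move/eqP: ep0; rewrite subr_eq0 => /eqP ->.
have eq : e * (e - p) = e - p by rewrite mulrBr ee ep.
right; exists p, (e - p); split=> //; first exact: peirce_sub.
  by rewrite addrC subrK.
by split=> //; exact: full_sub hee _ _.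
Qed.

Lemma central_multiple_of_multiple e :
  (forall S, corner e e S -> multiple e S) -> central_multiple e.
Proof. by move=> h c hc _; exact: h. Qed.

Lemma full_commuting_standard e : e * e = e -> full e e -> commuting_standard e.
Proof.
move=> ee hee; have [h|] := full_split ee hee; first exact: commuting_standard_multiple.
move=> [p [q [pq <- p0 q0 [hpq hqq hp]]]].
have [pp qq _ _] := pq.
apply: (commuting_standard_sum pq).
- exact: full_linked.
- exact: central_multiple_of_multiple.
- exact: full_central_multiple.
Qed.

Definition projects K P : Prop :=
  forall v, K (act P v) /\ forall w, K w -> ip (v - act P v) w = 0.

Lemma projection_unique K v u1 u2 : linear_subspace K -> K u1 -> K u2 ->
  (forall w, K w -> ip (v - u1) w = 0) -> (forall w, K w -> ip (v - u2) w = 0) -> u1 = u2.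
Proof.
move=> [K0 KL] K1 K2 h1 h2; have K12 : K (u1 - u2).
  by rewrite addrC -scaleN1r; apply: KL.
apply/eqP; rewrite -subr_eq0 -ip_eq0.
have {1}-> : u1 - u2 = (v - u2) - (v - u1) by rewrite opprB [RHS]addrC addrA subrK.
by rewrite ipBl h1 // h2 // subrr.
Qed.

Lemma exists_projects K : nest_set N K -> exists P, projects K P.
Proof.
move=> NK; have clK : closed_subspace K by case: (nestP N) => h _ _ _ _; exact: h.
have [Klin _] := clK; have [K0 KL] := Klin.
have /choice[f hf] : forall v, exists u, K u /\ forall w, K w -> ip (v - u) w = 0.
  by move=> v; exact: exists_projection.
have fix_f v : K v -> f v = v.
  move=> Kv; have [Kf of_] := hf v; apply: (projection_unique Klin Kf Kv of_) => w _.
  by rewrite subrr ip0l.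
have [P hP] : exists P, forall v, act P v = f v.
  apply: (@exists_operator _ _ _ _ _ _ 1) => [k x y|x|M x NM Mx].
  - have [Kx ox] := hf x; have [Ky oy] := hf y; have [Kxy oxy] := hf (k *: x + y).
    apply: (projection_unique Klin Kxy _ oxy); first exact: KL.
    move=> w Kw; have -> : k *: x + y - (k *: f x + f y) = k *: (x - f x) + (y - f y).
      by rewrite scalerBr opprD addrACA.
    by rewrite ipDl ipZl ox // oy // mulr0 addr0.
  (* The bound 1 comes from |f x|^2 = <x,f x> and the Cauchy-Schwarz inequality. *)
  - have [Kx ox] := hf x; rewrite mul1r.
    have [->|fx0] := eqVneq (f x) 0; first by rewrite normr0.
    have fgt : 0 < `|f x| by rewrite normr_gt0.
    rewrite -(ler_pM2r fgt) -expr2 -ip_norm.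
    have := ox _ Kx; rewrite ipBl => /eqP; rewrite subr_eq0 => /eqP <-.
    have := cauchy_schwarz x (f x); rewrite ger0_norm //.
    have := ox _ Kx; rewrite ipBl => /eqP; rewrite subr_eq0 => /eqP ->; exact: ip_ge0.
  (* A member M inside K is fixed pointwise; one that contains K contains the range. *)
  - have [_ tot _ _ _] := nestP N; have [MK|KM] := tot _ _ NM NK.
      by rewrite fix_f //; exact: MK.
    by apply: KM; have [] := hf x.
by exists P => v; rewrite hP; exact: hf.
Qed.


Section Projects.
Variables (K : set H) (P : A).
Hypotheses (NK : nest_set N K) (hP : projects K P).

Lemma projects_fix v : K v -> act P v = v.
Proof.
move=> Kv; apply/eqP; rewrite eq_sym -subr_eq0 -ip_eq0; have [KP oP] := hP v.
by rewrite ipBr !oP // subrr.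
Qed.

Lemma projects_mem v : K (act P v). Proof. exact: (hP v).1. Qed.

Lemma projects_ker v : (forall w, K w -> ip v w = 0) -> act P v = 0.
Proof.
move=> h; have [KP oP] := hP v; apply/eqP; rewrite -ip_eq0.
by have := oP _ KP; rewrite ipBl h // sub0r => /eqP; rewrite oppr_eq0.
Qed.

End Projects.

Lemma projects_mull K L P Q : nest_set N K -> projects K P -> projects L Q -> K `<=` L ->
  Q * P = P.
Proof.
move=> NK hP hQ KL; apply: act_ext => v; rewrite actM (projects_fix hQ) //.
by apply: KL; exact: projects_mem hP _.
Qed.

Lemma projects_mulr K L P Q : projects K P -> projects L Q -> K `<=` L -> P * Q = P.
Proof.
move=> hP hQ KL; apply: act_ext => v; rewrite actM.
have -> : act Q v = v - (v - act Q v) by rewrite opprB addrC subrK.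
rewrite -[X in act P X]addrC -scaleN1r act_lin [X in _ *: X + _](projects_ker hP).
  by rewrite scaler0 add0r.
by move=> w Kw; have [_ ->] := hQ v; last exact: KL.
Qed.

Definition interval e : Prop := exists K1 K2 P1 P2,
  [/\ nest_set N K1, nest_set N K2, K1 `<=` K2, projects K1 P1 &
      projects K2 P2 /\ e = P2 - P1].

Lemma interval_idem e : interval e -> e * e = e.
Proof.
move=> [K1 [K2 [P1 [P2 [N1 N2 K12 h1 [h2 ->]]]]]].
have h K : K `<=` K by exact: subset_refl.
rewrite mulrBl !mulrBr (projects_mulr h2 h2) ?(projects_mull N1 h1 h2) //.
by rewrite (projects_mulr h1 h2) // (projects_mulr h1 h1) // subrr subr0.
Qed.

(** A member K strictly between K1 and K2 cuts the interval, and each M is comparable with K: either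
    q kills M or the range of p lies in M, so rank one operators from q to p preserve the nest.
    Without such a K, each M lies in K1 or contains K2, and the same holds with e on both sides. *)
Lemma interval_split e : interval e -> full e e \/
  exists p q, [/\ interval p, interval q, peirce p q, p + q = e &
                  [/\ p != 0, q != 0 & full p q]].
Proof.
move=> [K1 [K2 [P1 [P2 [N1 N2 K12 h1 [h2 ->]]]]]].
have [_ tot _ _ _] := nestP N.
have [|hK] := pselect (exists K, [/\ nest_set N K, ~ K `<=` K1 & ~ K2 `<=` K]).
  move=> [K [NK nK1 nK2]]; right.
  have K1K : K1 `<=` K by case: (tot _ _ N1 NK).
  have KK2 : K `<=` K2 by case: (tot _ _ NK N2).
  have [P hP] := exists_projects NK; have sub L : L `<=` L by exact: subset_refl.
  have [P11 PP P22] := And3 (projects_mulr h1 h1 (sub _)) (projects_mulr hP hP (sub _))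
    (projects_mulr h2 h2 (sub _)).
  have [P1P P12 PP2] := And3 (projects_mulr h1 hP K1K) (projects_mulr h1 h2 K12)
    (projects_mulr hP h2 KK2).
  have [PP1 P21 P2P] := And3 (projects_mull N1 h1 hP K1K) (projects_mull N1 h1 h2 K12)
    (projects_mull NK hP h2 KK2).
  exists (P - P1), (P2 - P); split.
  - by exists K1, K, P1, P; split.
  - by exists K, K2, P, P2; split.
  - by split; rewrite mulrBl !mulrBr ?P11 ?PP ?P22 ?P1P ?P12 ?PP2 ?PP1 ?P21 ?P2P;
      rewrite ?subrr ?subr0.
  - by rewrite addrC addrA subrK.
  split.
  - apply/eqP => /eqP; rewrite subr_eq0 => /eqP E; apply: nK1 => v Kv.
    by rewrite -(projects_fix hP Kv) E; exact: projects_mem h1 _.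
  - apply/eqP => /eqP; rewrite subr_eq0 => /eqP E; apply: nK2 => v Kv.
    by rewrite -(projects_fix h2 Kv) E; exact: projects_mem hP _.
  - move=> u w pu; apply: rank_one_operator => M v NM Mv.
    have [MK|KM] := tot _ _ NM NK; [left | right].
      have Kv := MK _ Mv; have K2v := KK2 _ Kv.
      by rewrite actB (projects_fix hP Kv) (projects_fix h2 K2v) subrr ip0l.
    apply: KM; rewrite -pu actB addrC -scaleN1r; apply: (nest_closed_lin _ NK).
      by apply: K1K; exact: projects_mem h1 _.
    exact: projects_mem hP _.
left => u w eu; apply: rank_one_operator => M v NM Mv.
have [MK1|nMK1] := pselect (M `<=` K1); [left | right].
  have K1v := MK1 _ Mv; have K2v := K12 _ K1v.
  by rewrite actB (projects_fix h1 K1v) (projects_fix h2 K2v) subrr ip0l.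
have K2M : K2 `<=` M by apply: contrapT => nK2M; apply: hK; exists M.
apply: K2M; rewrite -eu actB addrC -scaleN1r; apply: (nest_closed_lin _ N2).
  by apply: K12; exact: projects_mem h1 _.
exact: projects_mem h2 _.
Qed.

Lemma interval_central_multiple e : interval e -> central_multiple e.
Proof.
move=> ie; have ee := interval_idem ie.
have [hee|[p [q [ip_ iq pq <- [p0 q0 hpq]]]]] := interval_split ie.
  exact: full_central_multiple.
have [pp qq _ _] := pq.
by apply: (central_multiple_sum pq); exact: full_linked.
Qed.

Lemma interval_commuting_standard e : interval e -> commuting_standard e.
Proof.
move=> ie; have ee := interval_idem ie.
have [hee|[p [q [ip_ iq pq <- [p0 q0 hpq]]]]] := interval_split ie.
  exact: full_commuting_standard.
have [pp qq _ _] := pq.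
apply: (commuting_standard_sum pq); first exact: full_linked.
  exact: interval_central_multiple.
exact: interval_central_multiple.
Qed.

Lemma interval1 : interval 1.
Proof.
have [_ _ [N0 NT] _ _] := nestP N.
exists [set 0], [set: H], 0, 1; split=> //; last first.
  split; last by rewrite subr0.
  by move=> v; split=> // w _; rewrite act1 subrr ip0l.
by move=> v; split=> // w ->; rewrite ip0r.
Qed.

Lemma full_good_splitting p q : peirce p q -> p + q = 1 -> p != 0 -> q != 0 ->
  full p q -> central_multiple p -> central_multiple q ->
  commuting_standard p -> commuting_standard q -> good_splitting p q.
Proof.
move=> pq pq1 p0 q0 hpq cp cq sp sq; have [pp qq _ _] := pq; split=> //.
- exact: full_linked.
- exact: full_linked2.
- exact: full_left.
- exact: full_right.
Qed.

(** The first alternative is reached when the nest is trivial and a rank one idempotent already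
    exhausts the identity. *)
Lemma nest_alg_splitting : (forall S, multiple 1 S) \/ exists p q, good_splitting p q.
Proof.
have c1 S : corner 1 1 S by split; rewrite ?mul1r ?mulr1.
have [h1|[p [q [ip_ iq pq pq1 [p0 q0 hpq]]]]] := interval_split interval1; last first.
  right; exists p, q; apply: full_good_splitting => //;
    by [exact: interval_central_multiple | exact: interval_commuting_standard].
have [h|[p [q [pq pq1 p0 q0 [hpq hqq hp]]]]] := full_split (mul1r _) h1.
  by left=> S; exact: h.
have [pp qq _ _] := pq.
right; exists p, q; apply: full_good_splitting => //.
- exact: central_multiple_of_multiple.
- exact: full_central_multiple.
- exact: commuting_standard_multiple.
- exact: full_commuting_standard.
Qed.

End Splittings.

(** * A scalar commutator of bounded operators vanishes *)

Section Commutators.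
Context {R : realType} {H : hilbertType R} (N : nest H) (x0 : H) (x0_neq0 : x0 != 0).
Local Notation A := (nz_nest_alg N x0_neq0).
Implicit Types (S T : A) (k : R[i]) (n : nat).

Lemma commutator_power S T k n : S * T - T * S = k *: 1 ->
  S ^+ n.+1 * T - T * S ^+ n.+1 = (n.+1%:R * k) *: S ^+ n.
Proof.
move=> h; elim: n => [|n IH]; first by rewrite expr1 expr0 mul1r.
have -> : S ^+ n.+2 * T - T * S ^+ n.+2
    = S * (S ^+ n.+1 * T - T * S ^+ n.+1) + (S * T - T * S) * S ^+ n.+1.
  rewrite (exprS S n.+1) mulrBr mulrBl !mulrA.
  by rewrite [RHS]addrA subrK.
rewrite IH h -scalerAr -scalerAl mul1r -exprS -scalerDl.
by rewrite (mulrSr _ n.+1) mulrDl mul1r.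
Qed.


(* As [S^(n+1), T] = (n+1) k S^n, any bound on S^n can be halved once n is large. *)
Lemma commutator_power_bound S T k n (C D K : R) : S * T - T * S = k *: 1 ->
  0 <= C -> 0 <= D ->
  (forall x, `|act S x| <= C%:C * `|x|) -> (forall x, `|act T x| <= D%:C * `|x|) ->
  4 * C * D <= n.+1%:R * complex.Re `|k| -> k != 0 -> 0 <= K ->
  (forall x, `|act (S ^+ n) x| <= K%:C * `|x|) ->
  forall x, `|act (S ^+ n) x| <= (K / 2)%:C * `|x|.
Proof.
move=> h C0 D0 hC hD hn k0 K0 hK x.
have nk0 : 0 < n.+1%:R * `|k| :> R[i] by rewrite mulr_gt0 ?ltr0n ?normr_gt0.
rewrite -(ler_pM2l nk0).
have -> : n.+1%:R * `|k| * `|act (S ^+ n) x|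
    = `|act S (act (S ^+ n) (act T x)) - act T (act S (act (S ^+ n) x))|.
  rewrite -{1}(normr_nat R[i] n.+1) -normrM -normrZ -actZ -(commutator_power n h).
  by rewrite actB exprS !actM.
apply: le_trans (ler_normB _ _) _.
(* Each product contributes CKD|x|, and 2CKD <= (n+1)|k| K/2 is the assumption on n; hence its
   constant 4. *)
have b1 : `|act S (act (S ^+ n) (act T x))| <= (C * K * D)%:C * `|x|.
  apply: le_trans (hC _) _; rewrite !rmorphM /= -!mulrA.
  apply: ler_wpM2l; first by rewrite ler0c.
  apply: le_trans (hK _) _; apply: ler_wpM2l; first by rewrite ler0c.
  exact: hD.
have b2 : `|act T (act S (act (S ^+ n) x))| <= (C * K * D)%:C * `|x|.
  apply: le_trans (hD _) _; rewrite [C * K * D]mulrC !rmorphM /= -!mulrA.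
  apply: ler_wpM2l; first by rewrite ler0c.
  apply: le_trans (hC _) _; apply: ler_wpM2l; first by rewrite ler0c.
  exact: hK.
apply: le_trans (lerD b1 b2) _; rewrite -mulrDl mulrA; apply: ler_wpM2r => //.
have -> : `|k| = (complex.Re `|k|)%:C by rewrite RRe_real // normr_real.
move: (complex.Re `|k|) hn => r hn.
rewrite -[n.+1%:R](rmorph_nat (real_complex R)) -!(rmorphM, rmorphD) /= lecR.
have := ler_wpM2r K0 hn; lra.
Qed.

(** If k is nonzero, repeated halving of the bound gives S^n = 0 for a large n. Then [S^(n+1),T] =
    (n+1) k S^n lowers the exponent step by step, down to 1 = 0. *)
Lemma commutator_scalar_eq0 S T k : S * T - T * S = k *: 1 -> k = 0.
Proof.
move=> h; apply/eqP/negP => /negP k0.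
have [C C0 hC] := act_bounded S; have [D D0 hD] := act_bounded T.
have rk : 0 < complex.Re `|k|.
  by rewrite -ltcR RRe_real ?normr_real // normr_gt0.
have [n hn] : exists n, 4 * C * D <= n.+1%:R * complex.Re `|k|.
  exists (Num.trunc (4 * C * D / complex.Re `|k|)).
  by rewrite -ler_pdivrMr // ltW // truncnS_gt.
have [K K0 hK] := act_bounded (S ^+ n).
have Kj j x : `|act (S ^+ n) x| <= (K / 2 ^+ j)%:C * `|x|.
  elim: j x => [|j IH] x; first by rewrite expr0 divr1.
  rewrite exprSr invfM mulrA.
  by apply: (commutator_power_bound h C0 D0 hC hD hn k0 _ IH); rewrite divr_ge0 ?exprn_ge0.
have Sn0 : S ^+ n = 0.
  apply: act_ext => x; rewrite act0; apply/eqP; rewrite -normr_eq0; apply/negP => /negP a0.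
  have {a0}a0 : 0 < complex.Re `|act (S ^+ n) x|.
    by rewrite -ltcR RRe_real ?normr_real // lt_def a0 normr_ge0.
  have := truncnS_gt (K * complex.Re `|x| / complex.Re `|act (S ^+ n) x|).
  move: (Num.trunc _) => j; apply/negP; rewrite -leNgt ler_pdivlMr //.
  have : (j.+1%:R : R) <= 2 ^+ j.+1 by rewrite -natrX ler_nat ltnW // ltn_expl.
  move=> hj; apply: le_trans (ler_wpM2r (ltW a0) hj) _.
  rewrite mulrC -ler_pdivlMr ?exprn_gt0 // mulrAC.
  have := Kj j.+1 x.
  by rewrite -[`|act _ x|]RRe_real ?normr_real // -[`|x|]RRe_real ?normr_real // -rmorphM lecR.
elim: n Sn0 {hn hK Kj} => [|n IH] Sn0.
  by move/eqP: Sn0; rewrite expr0 oner_eq0.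
apply: IH; have := commutator_power n h; rewrite Sn0 mul0r mulr0 subrr => /esym/eqP.
by rewrite scaler_eq0 mulf_eq0 (negbTE k0) orbF pnatr_eq0 => /eqP.
Qed.

End Commutators.

(** * Return from the polarized form to the trace *)

(** The factor 2 in B(a,a) = 2 q(a,a) matches the two copies of z a^2 and of mu(a) a, so z and mu
    pass to the trace unchanged. *)
Lemma half_reduced_form (F : numFieldType) (A : algType F) (a b : A) (k z : F) :
  b = (z *: 1) * a ^+ 2 + (k *: 1) * a
      + 2^-1 *: (2 *: b - z *: (a * a + a * a) - k *: a - k *: a).
Proof. by rewrite expr2; nc_ring. Qed.

Section Conclusion.
Context {R : realType} {H : hilbertType R} (N : nest H).
Local Notation A := (nest_alg N).

Lemma ring_center_scale (k : R[i]) : ring_center (k *: (1 : A)).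
Proof. by move=> x; rewrite -nest_alg_scaleAl -nest_alg_scaleAr mul1r mulr1. Qed.

Lemma proper_trace_of_scalars (q : {bilinear A -> A -> A}) :
  (forall S : A, exists k : R[i], S = k *: (1 : A)) -> proper_trace (trace_of q).
Proof.
move=> h; have center (S : A) : ring_center S.
  by have [k ->] := h S; exact: ring_center_scale.
exists 0, \0, (trace_of q); split=> //.
- by exists q.
- by move=> a; rewrite /= !mul0r !add0r.
Qed.

Section Nontrivial.
Variables (x0 : H) (x0_neq0 : x0 != 0).
Local Notation B := (nz_nest_alg N x0_neq0).
Variable q : {bilinear A -> A -> A}.

Definition polarization (x y : B) : B := q x y + q y x.

Lemma center_multiple (c : B) : ring_center c -> multiple 1 c.
Proof.
move=> hc; apply: (interval_central_multiple (interval1 N x0_neq0)) => [|x _]; last exact: hc.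
by split; rewrite ?mul1r ?mulr1.
Qed.

Lemma polarization_commuting_form :
  centralizing (trace_of q) -> commuting_form polarization.
Proof.
move=> hq; apply: commuting_form_of_diagonal.
- by move=> x y; rewrite /polarization addrC.
- move=> x k y y'; rewrite /polarization.
  by rewrite (linearPr q x k y y') (linearPl q x k y y') /= scalerDr addrACA.
- move=> a; have [k hk] := center_multiple (hq a).
  have k0 : k = 0 := commutator_scalar_eq0 hk.
  move: hk; rewrite k0 scale0r /ring_commutator => h.
  rewrite /polarization mulrDl mulrDr opprD addrACA.
  by rewrite (h : q a a * a - a * q a a = 0) addr0.
Qed.

Lemma proper_trace_of_polarization (z : R[i]) (mu : B -> R[i]) :
  commuting_form polarization -> functional mu ->
  (forall a b, multiple 1
    (polarization a b - z *: (a * b + b * a) - mu a *: b - mu b *: a)) ->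
  proper_trace (trace_of q).
Proof.
move=> BP mulin hB; have B'P := commuting_form_sub z BP mulin.
set B' := fun x y : B => _ in B'P.
pose m (a : A) : A := mu a *: (1 : A).
have mlin : linear m by move=> k a b; rewrite /m mulin scalerDl scalerA.
pose mL : {linear A -> A} := HB.pack m (GRing.isLinear.Build _ _ _ _ m mlin).
pose b (x y : A) : A := (2^-1 : R[i]) *: (B' x y : A).
have blin : bilinear_for ( *:%R : R[i] -> A -> A) *:%R b.
  have scaleCA (j l : R[i]) (c : A) : j *: (l *: c) = l *: (j *: c).
    by rewrite !scalerA mulrC.
  split=> [y k x x'|x k y y']; rewrite /b.
    rewrite (form_sym B'P) (form_lin B'P) !(form_sym B'P y) scalerDr.
    by congr (_ + _); exact: scaleCA.
  by rewrite (form_lin B'P) scalerDr; congr (_ + _); exact: scaleCA.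
pose bL : {bilinear A -> A -> A} :=
  HB.pack b (bilinear_isBilinear.Build R[i] A A A *:%R *:%R b blin).
exists (z *: (1 : A)), mL, (trace_of bL); split.
- exact: ring_center_scale.
- by move=> a; exact: ring_center_scale.
- exists bL => // x y; have [k hk] := hB x y.
  have -> : bL x y = (2^-1 * k) *: (1 : A) by rewrite -scalerA -hk.
  exact: ring_center_scale.
- move=> a.
  have E : polarization a a = (2 : R[i]) *: (q a a : B).
    by rewrite /polarization scaler_nat mulr2n.
  have : (q a a : B) = (z *: 1) * (a : B) ^+ 2 + (mu a *: 1) * (a : B)
      + (2^-1 : R[i]) *: B' a a.
    by rewrite /B' E; exact: half_reduced_form.
  exact.
Qed.

End Nontrivial.
End Conclusion.

Theorem corollary3p13 (R : realType) (H : hilbertType R) (N : nest H)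
    (q : {bilinear nest_alg N -> nest_alg N -> nest_alg N}) :
  centralizing (trace_of q) -> proper_trace (trace_of q).
Proof.
move=> hq; have [[x0 x0_neq0]|H0] := pselect (exists x : H, x != 0); last first.
  (* On the zero space every operator equals 0 times the identity. *)
  apply: proper_trace_of_scalars => S; exists 0; apply: val_inj; apply/funext => x.
  apply: contrapT => Sx; apply: H0; exists (nest_alg_op S x).
  by apply/eqP => Sx0; apply: Sx; exact: etrans Sx0 (esym (scale0r x)).
have [h|[p [r pr]]] := nest_alg_splitting N x0_neq0.
  by apply: proper_trace_of_scalars => S; have [k hk] := h S; exists k; exact: hk.
have BP := polarization_commuting_form x0_neq0 hq.
have [z [mu [mulin hB]]] := commuting_form_standard pr BP.
exact: proper_trace_of_polarization BP mulin hB.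
Qed.
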